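(* Let $\|\cdot\|$ be a norm on $\mathbb{R}^3$. For any non-zero square $d\in\mathbb{Z}$ there exists $c_0>0$ such that, as $T\to\infty$, $$\#\{q\in\mathcal{B}_d(\mathbb{Z}):\ \|q\|<T\}\sim c_0\cdot T\log T.$$
   Context: For a binary quadratic form $q(x,y)=ax^2+bxy+cy^2$ the discriminant is $\mathrm{disc}(q)=b^2-4ac$, and $\|q\|:=\|(a,b,c)\|$. $\mathcal{B}_d(\mathbb{Z})$ denotes the set of integral binary quadratic forms ($a,b,c\in\mathbb{Z}$) of discriminant $d$. *)

(* Defs.v *)
From mathcomp Require Export all_boot all_order all_algebra finmap.
From mathcomp Require Export all_classical all_reals all_analysis.
Export numFieldNormedType.Exports.
Import Order.TTheory GRing.Theory Num.Theory.

Set Implicit Arguments.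
Unset Strict Implicit.
Unset Printing Implicit Defensive.

Local Open Scope classical_set_scope.
Local Open Scope ring_scope.

(* Makes the Landau notations, in particular ~_, available at +oo. *)
Canonical pinfty_filter_on (R : realType) : filter_on R :=
  FilterType (pinfty_nbhs R) (@filter_filter _ _ (@proper_pinfty_nbhs R)).

(* The fields are those of the factory Lmodule_isNormed; an arbitrary norm
   cannot be a canonical instance on 'rV[R]_n, which carries the sup norm. *)
Record is_norm (R : realType) (n : nat) (N : 'rV[R]_n -> R) : Prop := IsNorm {
  is_norm_triangle : forall v w, N (v + w) <= N v + N w;
  is_norm_homogeneous : forall (a : R) v, N (a *: v) = `|a| * N v;
  is_norm_eq0 : forall v, N v = 0 -> v = 0
}.

(* a x^2 + b x y + c y^2 is encoded as the row vector (a, b, c). *)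
Definition bqf (A : Type) := 'rV[A]_3.

Section Bqf.
Variable A : comPzRingType.
Implicit Types q : bqf A.

Definition bqf_a q : A := q 0 (inord 0).
Definition bqf_b q : A := q 0 (inord 1).
Definition bqf_c q : A := q 0 (inord 2).

Definition disc q : A := bqf_b q ^+ 2 - 4%:R * bqf_a q * bqf_c q.

End Bqf.

Definition int_bqf (d : int) : set (bqf int) := [set q | disc q = d].

(* ||q|| for an integral form q, via the inclusion of Z^3 in R^3. *)
Definition bqf_norm (R : realType) (N : 'rV[R]_3 -> R) (q : bqf int) : R :=
  N (map_mx intr q).

(* fset_set sends an infinite set to the empty finite set, so the count would
   be 0 in that case; for a norm N the set below is always finite. *)
Definition bqf_count (R : realType) (N : 'rV[R]_3 -> R) (d : int) (T : R) : nat :=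
  #|` fset_set [set q | int_bqf d q /\ bqf_norm N q < T] |.

(* Main.v *)
Require Import Defs.
From mathcomp Require Import ring lra zify.

Set Implicit Arguments.
Unset Strict Implicit.
Unset Printing Implicit Defensive.

Import Order.TTheory GRing.Theory Num.Theory.
Local Open Scope classical_set_scope.
Local Open Scope ring_scope.

(** Write [d = k^2] with [k > 0].  A form of discriminant [k^2] is a product
    [q = v * w] of integral linear forms with [v] primitive and [det(v, w) = k],
    and the pair is unique up to a common sign ([bqf_factorization],
    [lin_mul_inj]).  For a fixed primitive [v] choose [u] with [det(v, u) = 1]
    and [|u| <= |v|]; then [w] runs over the vectors [t v + k u], so the forms
    with first root [v] are the arithmetic progression [t v^2 + k v u], with [t]
    an integer.  The norm of [k v u] is at most a constant times that of [v^2],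
    hence [2 T / N(v^2) + O(1)] of these forms have norm less than [T].

    There are too many [v] to sum this error over all of them.  But [q -> - q]
    preserves the norm and exchanges the two roots, and the product of the sup
    norms of the two roots is at most the largest coefficient of [q] plus [k];
    so [q] or [- q] has its first root in the box [|v| <= n], where
    [n^2] is of the order of [T] ([small_root_exists]).  This gives an upper
    bound for the count.  The same bound holds from below, because for
    [|t| > 2 k] the first root is strictly the shorter one, so that the forms
    [q] and [- q] obtained from the box do not collide ([root_form_far_opp]).
    The box has [O(T)] vectors, and therefore the count is
      [4 T * S(n) + O(T)],
    [S(n)] being the sum of [1 / N(v^2)] over the primitive [v] of the box modulo
    sign ([bqf_count_sandwich]).

    It remains to see that [S(n) = c ln n + O(1)] with [c > 0].  The function
    [1 / N(v^2)] is homogeneous of degree [-2], so the vectors [v] of sup norm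
    [p] contribute [p^-2] times the sum of a Lipschitz function [g] over the
    fractions [j / p] with [j] coprime to [p].  Without the coprimality
    condition the sum over [j] is a Riemann sum [I p + O(1)].  Sorting the
    vectors by the gcd of their coordinates turns this into
      [sum over e of e^-2 S(n / e) = I H(n) + O(1)],
    [H] being the harmonic sum.  Since the terms [e >= 2] have total weight at
    most [3/4], induction on [n] shows that [S(n) - (I / zeta(2)) H(n)] is
    bounded ([hsum_deconvolution], [farey_sum_asymptotic]).  Finally [n] is of
    the order of the square root of [T], so [ln n = (ln T) / 2 + O(1)]. *)

(** * Harmonic sums and their deconvolution *)

(** The supremum of [lo] is such a point.  This produces both the value of
    [zeta(2)] and the limit of Riemann sums together with a bound for the error. *)
Lemma separating_point (R : realType) (lo hi : nat -> R) :
  (forall p m, (0 < p)%N -> (0 < m)%N -> lo p <= hi m) ->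
  exists I, forall p, (0 < p)%N -> lo p <= I <= hi p.
Proof.
move=> lohi; pose A := [set x | exists2 p, (0 < p)%N & x = lo p].
have A0 : A !=set0 by exists (lo 1%N); exists 1%N.
exists (sup A) => p p0; apply/andP; split.
  apply: ub_le_sup; last by exists p.
  by exists (hi p) => _ [m m0 ->]; exact: lohi.
by apply: ge_sup => // _ [m m0 ->]; exact: lohi.
Qed.

Lemma sum_inv_sqr_tail (R : realType) (a n : nat) : (0 < a <= n)%N ->
  \sum_(a.+1 <= e < n.+1) (e%:R ^- 2 : R) <= a%:R^-1 - n%:R^-1.
Proof.
case/andP=> a0; elim: n => [|n IH]; first by case: a a0.
rewrite leq_eqVlt => /orP[/eqP <-|]; first by rewrite big_geq ?subrr.
rewrite ltnS => an; rewrite big_nat_recr //=.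
have n0 : (0 < n%:R :> R) by rewrite ltr0n (leq_trans a0).
have := IH an; set s := \sum_(_ <= e < _) _ => sle.
have : (n.+1%:R ^- 2 : R) <= n%:R^-1 - n.+1%:R^-1.
  rewrite -natr1; move: {sle} (n%:R) n0 => x x0.
  have -> : x^-1 - (x + 1)^-1 = (x * (x + 1))^-1 by field; lra.
  rewrite lef_pV2 ?posrE ?exprn_gt0 ?mulr_gt0 //; nra.
by move=> nle; rewrite (le_trans (lerD sle nle)) // addrA subrK.
Qed.

Definition hsum (R : realType) (n : nat) : R := \sum_(1 <= m < n.+1) m%:R^-1.

Lemma hsumS (R : realType) n : hsum R n.+1 = hsum R n + n.+1%:R^-1.
Proof. by rewrite /hsum big_nat_recr. Qed.

Lemma hsum0 (R : realType) : hsum R 0 = 0.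
Proof. by rewrite /hsum big_geq. Qed.

Lemma hsum_ge0 (R : realType) n : 0 <= hsum R n.
Proof. by apply: sumr_ge0 => i _; rewrite invr_ge0. Qed.

Lemma hsum_le (R : realType) n : hsum R n <= n%:R.
Proof.
elim: n => [|n IH]; first by rewrite hsum0.
by rewrite hsumS -[n.+1%:R in leRHS]natr1 lerD // invf_le1 ?ler1n ?ltr0n.
Qed.

Lemma ln_le_hsum (R : realType) n : ln (n.+1%:R : R) <= hsum R n.
Proof.
elim: n => [|n IH]; first by rewrite ln1 hsum0.
have n0 : (0 < n.+1%:R :> R) by [].
have -> : (n.+2%:R : R) = n.+1%:R * (1 + n.+1%:R^-1).
  by rewrite mulrDr mulr1 mulfV ?gt_eqF // -natr1.
rewrite hsumS lnM ?posrE // ?addr_gt0 ?invr_gt0 //.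
by rewrite lerD // le_ln1Dx // (lt_trans (ltrN10 _)) ?invr_gt0.
Qed.

Lemma hsum_le_ln (R : realType) n : (0 < n)%N -> hsum R n <= 1 + ln n%:R.
Proof.
elim: n => // -[|n] IH _; first by rewrite hsumS hsum0 ln1 add0r invr1 addr0.
have n0 : (0 < n.+1%:R :> R) by [].
have m0 : (0 < n.+2%:R :> R) by [].
have E : (n.+1%:R : R) = n.+2%:R * (1 + - n.+2%:R^-1).
  by rewrite mulrDr mulr1 mulrN mulfV ?gt_eqF // -(natr1 n.+1) addrK.
have y1 : (n.+2%:R^-1 : R) < 1 by rewrite invf_lt1 // ltr1n.
rewrite hsumS; have := IH isT; rewrite [X in ln X]E lnM ?posrE // ?subr_gt0 //.
have := @le_ln1Dx R (- n.+2%:R^-1); rewrite ltrN2 => /(_ y1).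
move: (n.+2%:R^-1 : R) {E y1} => y; lra.
Qed.

(** Both sums are logarithms up to a bounded error, and [n < e (n %/ e + 1)]. *)
Lemma hsum_divn (R : realType) n e : (0 < e <= n)%N ->
  0 <= hsum R n - hsum R (n %/ e) <= 1 + hsum R e.
Proof.
case/andP=> e0 en; have n0 : (0 < n)%N := leq_trans e0 en.
apply/andP; split.
  rewrite /hsum (@big_cat_nat _ _ _ (n %/ e).+1 1 n.+1) //= ?ltnS ?leq_div //.
  by rewrite addrAC subrr add0r sumr_ge0 // => i _; rewrite invr_ge0.
have lt_n : (n <= e * (n %/ e).+1)%N by rewrite mulnC ltnW // ltn_ceil.
have : ln (n%:R : R) <= ln e%:R + ln (n %/ e).+1%:R.
  by rewrite -lnM ?posrE ?ltr0n // -natrM ler_ln ?posrE ?ltr0n ?muln_gt0 ?e0 // ler_nat.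
have : ln (e%:R : R) <= hsum R e.
  apply: le_trans (ln_le_hsum R e).
  by rewrite ler_ln ?posrE ?ltr0n // ler_nat.
have := @hsum_le_ln R n n0; have := ln_le_hsum R (n %/ e); lra.
Qed.

(** The series of [(1 + H(e)) / e^2] converges: its terms are dominated by the
    differences of the decreasing sequence [(H(e) + 2) / e]. *)
Lemma sum_hsum_inv_sqr (R : realType) n :
  \sum_(1 <= e < n.+1) (1 + hsum R e) * (e%:R ^- 2 : R) <= 5.
Proof.
case: n => [|n]; first by rewrite big_geq.
(* Subtracting the telescoping majorant makes the bound inductive. *)
suff : \sum_(1 <= e < n.+2) (1 + hsum R e) * (e%:R ^- 2 : R)
       <= 5 - (hsum R n.+1 + 2) / n.+1%:R.
  move/le_trans; apply; rewrite gerBl divr_ge0 //.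
  by rewrite addr_ge0 ?hsum_ge0.
elim: n => [|n IH].
  rewrite big_nat1 hsumS hsum0 expr1n invr1; lra.
rewrite big_nat_recr //= !(@hsumS R n.+1).
move: IH; set s := \sum_(_ <= e < _) _.
have := hsum_ge0 R n.+1; set h := hsum R n.+1.
have : (0 < n.+1%:R :> R) by [].
rewrite -(natr1 n.+1); move: (n.+1%:R) => x x0 h0 sle.
suff : (1 + (h + (x + 1)^-1)) * (x + 1) ^- 2 <=
   (h + 2) / x - (h + (x + 1)^-1 + 2) / (x + 1).
  by move=> step; rewrite (le_trans (lerD sle step)) // addrA subrK.
have -> : (h + 2) / x - (h + (x + 1)^-1 + 2) / (x + 1)
    = (1 + (h + (x + 1)^-1)) * (x * (x + 1))^-1 by field; lra.
rewrite ler_wpM2l //.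
  by rewrite addr_ge0 // addr_ge0 // invr_ge0; lra.
rewrite lef_pV2 ?posrE ?exprn_gt0 ?mulr_gt0 //; nra.
Qed.

Lemma zeta2_bounds (R : realType) : exists2 Z : R, 1 <= Z &
  forall n, (0 < n)%N -> 0 <= Z - \sum_(1 <= e < n.+1) e%:R ^- 2 <= n%:R^-1.
Proof.
pose s n : R := \sum_(1 <= e < n.+1) e%:R ^- 2.
have sD p m : (p <= m)%N -> s m = s p + \sum_(p.+1 <= e < m.+1) e%:R ^- 2.
  by move=> pm; rewrite /s (@big_cat_nat _ _ _ p.+1 1 m.+1).
have t0 p m : 0 <= \sum_(p.+1 <= e < m.+1) (e%:R ^- 2 : R).
  by apply: sumr_ge0 => i _; rewrite invr_ge0 exprn_ge0.
have [Z HZ] : exists Z, forall n, (0 < n)%N -> s n <= Z <= s n + n%:R^-1.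
  apply: separating_point => p m p0 m0.
  have [pm|/ltnW mp] := leqP p m.
    by rewrite (sD _ _ pm) -addrA lerDl addr_ge0 // invr_ge0.
  rewrite (sD _ _ mp) lerD2l.
  have : (0 < m <= p)%N by rewrite m0.
  by move=> /(sum_inv_sqr_tail R)/le_trans; apply; rewrite gerBl invr_ge0.
exists Z => [|n /HZ].
  by case/andP: (HZ 1%N isT); rewrite /s big_nat1 expr1n invr1.
by rewrite /s subr_ge0 lerBlDl.
Qed.

Lemma sum_inv_sqr_from2 (R : realType) n : 
  \sum_(2 <= e < n.+1) (e%:R ^- 2 : R) <= 3 / 4.
Proof.
case: n => [|[|n]]; [by rewrite big_geq | by rewrite big_geq | ].
rewrite big_ltn //; have := @sum_inv_sqr_tail R 2 n.+2 isT.
have : 0 <= (n.+2%:R^-1 : R) by rewrite invr_ge0.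
move: (n.+2%:R^-1 : R) => y; lra.
Qed.

(** A bounded perturbation of the harmonic sum stays one after division by the
    Dirichlet series of [e^-2].  With [c = I / zeta(2)] the difference
    [D = G - c H] has bounded convolution with [e^-2]; moving the terms [e >= 2],
    of total weight at most [3/4], to the other side gives
    [|D n| <= K0 + 3/4 max_{m < n} |D m|], so [4 K0] bounds [D] by induction. *)
Lemma hsum_deconvolution (R : realType) (G : nat -> R) (I K : R) : 0 < I ->
  (forall n, (0 < n)%N ->
     `|\sum_(1 <= e < n.+1) e%:R ^- 2 * G (n %/ e)%N - I * hsum R n| <= K) ->
  exists2 c, 0 < c & exists K', forall n, (0 < n)%N -> `|G n - c * hsum R n| <= K'.
Proof.
move=> I0 HK; have [Z Z1 HZ] := zeta2_bounds R.
have Z0 : 0 < Z by lra.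
exists (I / Z); first exact: divr_gt0.
set c := I / Z; have c0 : 0 < c by exact: divr_gt0.
have cZ : c * Z = I by rewrite /c divfK // gt_eqF.
pose D n := G n - c * hsum R n.
(* The error [c * 6] splits into [1] for the tail of [zeta(2)] times [H(n) <= n],
   and [5] for the differences [H(n) - H(n / e)]. *)
have sumD n : (0 < n)%N ->
    `|\sum_(1 <= e < n.+1) e%:R ^- 2 * D (n %/ e)%N| <= K + c * 6.
  move=> n0; have := HK n n0.
  have -> : \sum_(1 <= e < n.+1) e%:R ^- 2 * D (n %/ e)%N =
     (\sum_(1 <= e < n.+1) e%:R ^- 2 * G (n %/ e)%N - I * hsum R n) +
     c * ((Z - \sum_(1 <= e < n.+1) e%:R ^- 2) * hsum R n +
       \sum_(1 <= e < n.+1) (hsum R n - hsum R (n %/ e)) * e%:R ^- 2).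
    have -> : \sum_(1 <= e < n.+1) (hsum R n - hsum R (n %/ e)) * e%:R ^- 2 =
        hsum R n * \sum_(1 <= e < n.+1) e%:R ^- 2
        - \sum_(1 <= e < n.+1) e%:R ^- 2 * hsum R (n %/ e).
      rewrite mulr_sumr -sumrB; apply: eq_bigr => e _.
      by rewrite mulrBl [in X in _ - X]mulrC.
    have -> : \sum_(1 <= e < n.+1) e%:R ^- 2 * D (n %/ e)%N =
        \sum_(1 <= e < n.+1) e%:R ^- 2 * G (n %/ e)%N
        - c * \sum_(1 <= e < n.+1) e%:R ^- 2 * hsum R (n %/ e).
      rewrite mulr_sumr -sumrB; apply: eq_bigr => e _.
      by rewrite /D mulrBr mulrCA.
    rewrite -cZ; ring.
  set A := _ - _ * _; set B := (Z - _) * _; set C := \sum_(_ <= _ < _) _ => AK.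
  have [B0 B1] : 0 <= B /\ B <= 1.
    have /andP[z0 z1] := HZ n n0; split; first by rewrite mulr_ge0 ?hsum_ge0.
    apply: le_trans (_ : n%:R^-1 * n%:R <= 1).
      by apply: ler_pM; rewrite ?hsum_ge0 ?hsum_le.
    by rewrite mulVf // pnatr_eq0 -lt0n.
  have [C0 C5] : 0 <= C /\ C <= 5.
    split.
      rewrite /C big_nat sumr_ge0 // => e /andP[e0 en].
      rewrite mulr_ge0 ?invr_ge0 ?exprn_ge0 //.
      by have /andP[] := @hsum_divn R n e (introT andP (conj e0 en)).
    apply: le_trans (sum_hsum_inv_sqr R n).
    rewrite /C big_nat [leRHS]big_nat ler_sum // => e /andP[e0 en].
    rewrite ler_wpM2r ?invr_ge0 ?exprn_ge0 //.
    by have /andP[] := @hsum_divn R n e (introT andP (conj e0 en)).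
  apply: le_trans (ler_normD _ _) _; apply: lerD => //.
  rewrite ger0_norm; last by rewrite mulr_ge0 ?addr_ge0 // ltW.
  by rewrite ler_pM2l //; lra.
have K0 : 0 <= K + c * 6 by exact: le_trans (sumD 1%N isT).
exists (4 * (K + c * 6)) => n; rewrite -/(D n).
elim/ltn_ind: n => n IH n0; have := sumD n n0.
rewrite big_ltn // divn1 expr1n invr1 mul1r => Dn.
set S := \sum_(_ <= _ < _) _ in Dn.
have : `|S| <= 3 / 4 * (4 * (K + c * 6)).
  apply: le_trans (ler_norm_sum _ _ _) _.
  apply: le_trans (_ : \sum_(2 <= e < n.+1) e%:R ^- 2 * (4 * (K + c * 6)) <= _).
    rewrite big_nat [leRHS]big_nat ler_sum // => e /andP[e2 en].
    rewrite normrM ger0_norm ?invr_ge0 ?exprn_ge0 //.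
    rewrite ler_wpM2l ?invr_ge0 ?exprn_ge0 //; apply: IH.
      by rewrite ltn_Pdiv.
    by rewrite divn_gt0 // ltnW.
  rewrite -mulr_suml ler_wpM2r ?sum_inv_sqr_from2 //; lra.
have := ler_normB (D n + S) S; rewrite addrK; lra.
Qed.

(** * Sums of a Lipschitz function over reduced fractions *)

Lemma sum_multiples (V : nmodType) (e n : nat) (phi : nat -> V) : (0 < e)%N ->
  \sum_(1 <= p < n.+1 | (e %| p)%N) phi p = \sum_(1 <= i < (n %/ e).+1) phi (e * i)%N.
Proof.
move=> e0; elim: n => [|n IH]; first by rewrite div0n !big_geq.
rewrite big_mkcond big_nat_recr //= -big_mkcond IH divnS //.
case: ifP => [en|_]; last by rewrite addr0.
have E : (e * (n %/ e).+1 = n.+1)%N.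
  by have := divnK en; rewrite divnS // en add1n mulnC.
by rewrite add1n [in RHS]big_nat_recr //= E.
Qed.

Definition coprime_sum (R : realType) (g : R -> R) (p : nat) : R :=
  \sum_(1 <= j < (2 * p).+1 | coprime p j) g (j%:R / p%:R).

Definition farey_sum (R : realType) (g : R -> R) (n : nat) : R :=
  \sum_(1 <= p < n.+1) p%:R ^- 2 * coprime_sum g p.

(** Each fraction [j / p] is sorted by its reduced denominator [p / e], where
    [e = gcd(p, j)].  The bound [n] only serves to give all [p] the same
    range of divisors. *)
Lemma coprime_sum_divisors (R : realType) (g : R -> R) (p n : nat) : (0 < p <= n)%N ->
  \sum_(1 <= j < (2 * p).+1) g (j%:R / p%:R) =
  \sum_(1 <= e < n.+1 | (e %| p)%N) coprime_sum g (p %/ e).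
Proof.
case/andP=> p0 pn.
transitivity (\sum_(1 <= j < (2 * p).+1) \sum_(1 <= e < n.+1 | e == gcdn p j)
    g (j%:R / p%:R)).
  apply: eq_bigr => j _; rewrite big_nat1_eq.
  by rewrite gcdn_gt0 p0 ltnS (leq_trans _ pn) // dvdn_leq ?dvdn_gcdl.
rewrite (exchange_big_dep_nat (fun e => (e %| p)%N)) /=; last first.
  by move=> j e _ _ _ /eqP ->; exact: dvdn_gcdl.
apply: eq_bigr => e /dvdnP[p' pE]; subst p.
have [p'0 e0] : (0 < p')%N /\ (0 < e)%N by apply/andP; rewrite -muln_gt0.
rewrite mulnK // /coprime_sum [RHS]big_mkcond.
have -> : (2 * p' = 2 * (p' * e) %/ e)%N by rewrite mulnA mulnK.
pose phi j := if coprime p' (j %/ e) then g (j%:R / (p' * e)%:R) else 0.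
transitivity (\sum_(1 <= j < (2 * (p' * e)).+1 | (e %| j)%N) phi j).
  rewrite [RHS]big_mkcond [LHS]big_mkcond /=; apply: eq_bigr => j _.
  rewrite /phi; case: ifP => [/eqP E|nE].
    have ej : (e %| j)%N by rewrite [X in (X %| _)%N]E dvdn_gcdr.
    rewrite ej; move: E; case/dvdnP: ej => j' ->; rewrite mulnK // -muln_gcdl.
    by rewrite -{1}[e]mul1n => /eqP; rewrite eqn_pmul2r // eq_sym /coprime => ->.
  case: ifP => // /dvdnP[j' jE]; move: nE; rewrite jE mulnK // -muln_gcdl.
  by rewrite -{1}[e]mul1n eqn_pmul2r // eq_sym /coprime => ->.
rewrite sum_multiples //; apply: eq_bigr => i _; rewrite /phi mulKn //.
case: ifP => // _; congr g; rewrite mulnC !natrM.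
by rewrite -mulf_div divff ?mulr1 // pnatr_eq0 -lt0n.
Qed.

(** Cutting each interval of length [1 / p] into [m] parts changes the sum,
    suitably scaled, by at most [2 L m].  Hence the intervals
    [(B(p) - 2 L) / p, (B(p) + 2 L) / p] meet pairwise, and any common point is
    the limit of [B(p) / p]. *)
Lemma lipschitz_riemann_sum (R : realType) (g : R -> R) (L : R) :
  (forall x y, 0 <= x <= 2 -> 0 <= y <= 2 -> `|g x - g y| <= L * `|x - y|) ->
  exists I, forall p, (0 < p)%N ->
    `|\sum_(1 <= j < (2 * p).+1) g (j%:R / p%:R) - I * p%:R| <= 2 * L.
Proof.
move=> gL.
have L0 : 0 <= L.
  have := gL 0 1; rewrite sub0r normrN1 mulr1 => h.
  by apply: le_trans (h _ _) => //; lra.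
pose B p := \sum_(1 <= j < (2 * p).+1) g (j%:R / p%:R).
have BM p m : (0 < p)%N -> (0 < m)%N -> `|B (p * m)%N - m%:R * B p| <= 2 * L * m%:R.
  move=> p0 m0; have P0 : 0 < p%:R :> R by rewrite ltr0n.
  have M0 : 0 < m%:R :> R by rewrite ltr0n.
  have -> : B (p * m)%N = \sum_(0 <= i < 2 * p)
      \sum_(i * m <= j < i.+1 * m) g (j.+1%:R / (p * m)%:R).
    by rewrite -big_nat_mul -mulnA /B big_add1.
  have -> : m%:R * B p = \sum_(0 <= i < 2 * p)
      \sum_(i * m <= j < i.+1 * m) g (i.+1%:R / p%:R).
    rewrite /B big_add1 mulr_sumr; apply: eq_bigr => i _.
    by rewrite sumr_const_nat mulSn addnK mulr_natl.
  rewrite -sumrB; apply: le_trans (ler_norm_sum _ _ _) _.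
  apply: le_trans (_ : \sum_(0 <= i < 2 * p) L / p%:R * m%:R <= _); last first.
    rewrite sumr_const_nat subn0 -[leLHS]mulr_natl natrM le_eqVlt; apply/orP; left; apply/eqP.
    by field; lra.
  rewrite big_nat [leRHS]big_nat ler_sum // => i /andP[_ ip].
  rewrite -sumrB; apply: le_trans (ler_norm_sum _ _ _) _.
  apply: le_trans (_ : \sum_(i * m <= j < i.+1 * m) L / p%:R <= _); last first.
    by rewrite sumr_const_nat mulSn addnK mulr_natr.
  rewrite big_nat [leRHS]big_nat ler_sum // => j /andP[ij ji].
  have i2 : i.+1%:R <= 2 * p%:R :> R by rewrite -natrM ler_nat.
  have j2 : j.+1%:R <= 2 * (p%:R * m%:R) :> R.
    by rewrite -!natrM ler_nat; nia.
  apply: le_trans (gL _ _ _ _) _.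
  - by rewrite natrM divr_ge0 ?mulr_ge0 // ler_pdivrMr // mulr_gt0.
  - by rewrite divr_ge0 //= ler_pdivrMr.
  apply: ler_wpM2l => //.
  have -> : j.+1%:R / (p * m)%:R - i.+1%:R / p%:R
     = (j.+1%:R - i.+1%:R * m%:R) / m%:R / p%:R :> R.
    by rewrite natrM; field; lra.
  rewrite normrM [X in _ * X]ger0_norm ?invr_ge0 // -[leRHS]mul1r.
  rewrite ler_wpM2r ?invr_ge0 // normrM [X in _ * X]ger0_norm ?invr_ge0 //.
  rewrite ler_pdivrMr // mul1r ler_norml.
  have : j.+1%:R <= i.+1%:R * m%:R :> R by rewrite -natrM ler_nat.
  have : i.+1%:R * m%:R <= j.+1%:R + m%:R :> R by rewrite -natrM -natrD ler_nat; nia.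
  lra.
have [I HI] : exists I, forall p, (0 < p)%N ->
    (B p - 2 * L) / p%:R <= I <= (B p + 2 * L) / p%:R.
  apply: separating_point => p m p0 m0.
  rewrite ler_pdivrMr ?ltr0n // mulrAC ler_pdivlMr ?ltr0n //.
  have := BM p m p0 m0; have := BM m p m0 p0; rewrite mulnC !ler_distl; lra.
exists I => p p0; have := HI p p0.
rewrite ler_pdivrMr ?ltr0n // ler_pdivlMr ?ltr0n // -/(B p) ler_distl; lra.
Qed.

(** Sorting the pairs [(p, j)] by their gcd [e]: those with gcd [e] and
    [p <= n] are [e] times the coprime pairs with [p <= n / e]. *)
Lemma farey_sum_dilates (R : realType) (g : R -> R) (n : nat) :
  \sum_(1 <= e < n.+1) e%:R ^- 2 * farey_sum g (n %/ e) =
  \sum_(1 <= p < n.+1) p%:R ^- 2 * \sum_(1 <= j < (2 * p).+1) g (j%:R / p%:R).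
Proof.
transitivity (\sum_(1 <= p < n.+1) \sum_(1 <= e < n.+1 | (e %| p)%N)
    p%:R ^- 2 * coprime_sum g (p %/ e)); last first.
  rewrite big_nat [RHS]big_nat; apply: eq_bigr => p /andP[p0 pn].
  by rewrite (@coprime_sum_divisors _ g p n) ?p0 // mulr_sumr.
rewrite (exchange_big_dep_nat predT) //=.
apply: eq_big_nat => e /andP[e0 _].
rewrite sum_multiples // mulr_sumr.
rewrite /farey_sum; apply: eq_bigr => i _.
by rewrite mulKn // mulrA natrM exprMn [in RHS]invfM.
Qed.

Lemma farey_sum_asymptotic (R : realType) (g : R -> R) (L g0 : R) : 0 < g0 ->
  (forall x, 0 <= x <= 2 -> g0 <= g x) ->
  (forall x y, 0 <= x <= 2 -> 0 <= y <= 2 -> `|g x - g y| <= L * `|x - y|) ->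
  exists2 c, 0 < c & exists K, forall n, (0 < n)%N ->
    `|farey_sum g n - c * ln n%:R| <= K.
Proof.
move=> g00 gg0 gL; have [I HI] := lipschitz_riemann_sum gL.
have L0 : 0 <= 2 * L by apply: le_trans (HI 1%N isT).
have I0 : 0 < I.
  (* The sum at [p] is at least [2 p g0]; for large [p] this exceeds the error
     [2 L] in [I p], which forces [I] to be positive. *)
  pose p := Num.bound (2 * L / g0).
  have pL : 2 * L < p%:R * g0.
    by rewrite -ltr_pdivrMr // archi_boundP // divr_ge0 // ltW.
  have p0 : (0 < p)%N by rewrite -(ltr0n R) -(pmulr_lgt0 _ g00) (le_lt_trans L0).
  have B0 : (2 * p)%:R * g0 <= \sum_(1 <= j < (2 * p).+1) g (j%:R / p%:R).
    rewrite -[X in X%:R * g0 <= _](subn1 (2 * p).+1) mulr_natl -sumr_const_nat.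
    rewrite big_nat [leRHS]big_nat ler_sum // => j /andP[_ jp]; apply: gg0.
    by rewrite divr_ge0 //= ler_pdivrMr ?ltr0n // -natrM ler_nat.
  rewrite -(pmulr_lgt0 I (_ : 0 < p%:R)) ?ltr0n //.
  have := HI p p0; rewrite ler_distl natrM in B0 *; lra.
have HF n : (0 < n)%N ->
    `|\sum_(1 <= e < n.+1) e%:R ^- 2 * farey_sum g (n %/ e) - I * hsum R n| <= 4 * L.
  move=> n0; rewrite farey_sum_dilates /hsum mulr_sumr -sumrB.
  apply: le_trans (ler_norm_sum _ _ _) _.
  apply: le_trans (_ : \sum_(1 <= p < n.+1) p%:R ^- 2 * (2 * L) <= _).
    rewrite big_nat [leRHS]big_nat ler_sum // => p /andP[p0 _].
    have P0 : p%:R != 0 :> R by rewrite pnatr_eq0 -lt0n.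
    have -> : I / p%:R = p%:R ^- 2 * (I * p%:R) by field.
    rewrite -mulrBr normrM ger0_norm ?invr_ge0 ?exprn_ge0 //.
    by rewrite ler_wpM2l ?invr_ge0 ?exprn_ge0 // HI.
  rewrite -mulr_suml (_ : 4 * L = 2 * (2 * L)); last by ring.
  rewrite ler_wpM2r // big_ltn // expr1n invr1.
  have := sum_inv_sqr_from2 R n; lra.
have [c c0 [K HK]] := hsum_deconvolution I0 HF.
exists c => //; exists (K + c) => n n0.
have -> : farey_sum g n - c * ln n%:R =
  (farey_sum g n - c * hsum R n) + c * (hsum R n - ln n%:R) by ring.
apply: le_trans (ler_normD _ _) _; apply: lerD; first exact: HK.
rewrite normrM gtr0_norm // -[leRHS]mulr1 ler_pM2l // ler_norml.
have := @hsum_le_ln R n n0; have := ln_le_hsum R n.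
have : ln (n%:R : R) <= ln n.+1%:R by rewrite ler_ln ?posrE ?ltr0n // ler_nat.
lra.
Qed.

(** * Comparison of a norm with the sup norm *)

Lemma is_norm_opp (R : realType) n (N : 'rV[R]_n -> R) (hN : is_norm N) v :
  N (- v) = N v.
Proof. by rewrite -scaleN1r (is_norm_homogeneous hN) normrN1 mul1r. Qed.

Lemma is_norm_0 (R : realType) n (N : 'rV[R]_n -> R) (hN : is_norm N) : N 0 = 0.
Proof. by rewrite -(scale0r (0 : 'rV[R]_n)) (is_norm_homogeneous hN) normr0 mul0r. Qed.

Lemma is_norm_ge0 (R : realType) n (N : 'rV[R]_n -> R) (hN : is_norm N) v : 0 <= N v.
Proof.
have := is_norm_triangle hN v (- v).
by rewrite subrr is_norm_0 // is_norm_opp // -mulr2n pmulrn_lge0.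
Qed.

Lemma is_norm_dist (R : realType) n (N : 'rV[R]_n -> R) (hN : is_norm N) v w :
  `|N v - N w| <= N (v - w).
Proof.
rewrite ler_norml; have := is_norm_triangle hN (v - w) w.
have := is_norm_triangle hN (w - v) v; rewrite !subrK -opprB is_norm_opp //; lra.
Qed.

Lemma row_coord_le_norm (R : realType) n (v : 'rV[R]_n) i : `|v 0 i| <= `|v|.
Proof.
rewrite [leRHS]/Num.norm /= mx_normrE; apply/bigmax_geP; right => /=.
by exists (0, i).
Qed.

Lemma row_norm_le (R : realType) n (v : 'rV[R]_n) M : 0 <= M ->
  (forall i, `|v 0 i| <= M) -> `|v| <= M.
Proof.
move=> M0 vM; rewrite [leLHS]/Num.norm /= mx_normrE; apply/bigmax_leP; split=> //.
by case=> i j _ /=; rewrite ord1.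
Qed.

Lemma is_norm_le_sup (R : realType) n (N : 'rV[R]_n -> R) (hN : is_norm N) :
  exists2 C, 0 < C & forall v, N v <= C * `|v|.
Proof.
exists (1 + \sum_(i < n) N (delta_mx 0 i)).
  by rewrite ltr_pwDl // sumr_ge0 // => i _; exact: is_norm_ge0.
move=> v; apply: le_trans (_ : (\sum_(i < n) N (delta_mx 0 i)) * `|v| <= _); last first.
  by rewrite ler_wpM2r // lerDr.
rewrite [in leLHS](row_sum_delta v) mulr_suml.
elim/big_ind2 : _ => [|x a y b ha hb|i _].
- by rewrite is_norm_0.
- by apply: le_trans (is_norm_triangle hN _ _) _; exact: lerD.
- rewrite (is_norm_homogeneous hN) mulrC ler_wpM2l ?is_norm_ge0 //.
  exact: row_coord_le_norm.
Qed.

(** The minimum of [N] on the compact unit sphere of the sup norm is positive. *)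
Lemma is_norm_ge_sup (R : realType) n (N : 'rV[R]_n -> R) (hN : is_norm N) :
  exists2 c, 0 < c & forall v, c * `|v| <= N v.
Proof.
have [C C0 NC] := is_norm_le_sup hN.
pose S : set 'rV[R]_n := [set v | `|v| = 1].
have [[u Su]|S0] := pselect (S !=set0); last first.
  exists 1 => // v; have [->|v0] := eqVneq v 0; first by rewrite normr0 mulr0 is_norm_ge0.
  exfalso; apply: S0; exists (`|v|^-1 *: v).
  by rewrite /S /= normrZ normfV normr_id mulVf // normr_eq0.
have cN : continuous N.
  move=> v; have FF : Filter (nbhs v) := nbhs_filter v.
  apply/(@cvgrPdist_le _ _ _ (nbhs v)) => /= e e0; near=> w.
  apply: le_trans (is_norm_dist hN _ _) _; apply: le_trans (NC _) _.
  rewrite mulrC -ler_pdivlMr //; near: w; apply/nbhs_ballP.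
  exists (e / C) => [|w]; first exact: divr_gt0.
  by rewrite mx_norm_ball /ball_ /= => /ltW.
have cS : compact S.
  apply: bounded_closed_compact.
    by exists 1; split=> // x x1 v /= ->; exact: ltW.
  rewrite (_ : S = Num.norm @^-1` [set 1]); last by [].
  apply: closed_comp => [v _|]; first exact: norm_continuous.
  exact: closed_eq.
have [|v /set_mem vS vmin] := EVT_min_rV _ cS (continuous_subspaceT cN); first by exists u.
exists (N v).
  rewrite lt_neqAle is_norm_ge0 // andbT eq_sym; apply/eqP => /(is_norm_eq0 hN) v0.
  by move: vS; rewrite v0 /S /= normr0 => /esym/eqP; rewrite oner_eq0.
move=> w; have [->|w0] := eqVneq w 0; first by rewrite normr0 mulr0 is_norm_ge0.
have w0' : 0 < `|w| by rewrite normr_gt0.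
have /vmin : `|w|^-1 *: w \in S.
  by apply/mem_set; rewrite /S /= normrZ normfV normr_id mulVf // normr_eq0.
by rewrite (is_norm_homogeneous hN) ger0_norm ?invr_ge0 // mulrC ler_pdivlMr.
Unshelve. all: by end_near.
Qed.

(** * Integral forms of square discriminant as products of linear forms *)

Definition bqf_mk (A : nmodType) (a b c : A) : bqf A := \row_i [:: a; b; c]`_i.

Lemma bqf_mkK (A : nmodType) (a b c : A) :
  [/\ bqf_mk a b c 0 (inord 0) = a, bqf_mk a b c 0 (inord 1) = b
    & bqf_mk a b c 0 (inord 2) = c].
Proof. by rewrite !mxE !inordK. Qed.

Lemma bqf_mkE (A : comPzRingType) (q : bqf A) :
  q = bqf_mk (bqf_a q) (bqf_b q) (bqf_c q).
Proof.
apply/rowP => i; rewrite !mxE /bqf_a /bqf_b /bqf_c -[in LHS](inord_val i).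
by case: i => [[|[|[|//]]] ?].
Qed.

Lemma bqf_mk_inj (A : comPzRingType) (a b c a' b' c' : A) :
  bqf_mk a b c = bqf_mk a' b' c' -> [/\ a = a', b = b' & c = c'].
Proof.
have [Ea Eb Ec] := bqf_mkK a b c; have [Ea' Eb' Ec'] := bqf_mkK a' b' c'.
move=> E; rewrite E in Ea Eb Ec.
by split; [exact: etrans (esym Ea) Ea' | exact: etrans (esym Eb) Eb'
  | exact: etrans (esym Ec) Ec'].
Qed.

Lemma disc_bqf_mk (A : comPzRingType) (a b c : A) :
  disc (bqf_mk a b c) = b ^+ 2 - 4%:R * a * c.
Proof. by rewrite /disc /bqf_a /bqf_b /bqf_c; have [-> -> ->] := bqf_mkK a b c. Qed.

Lemma bqf_mkN (A : zmodType) (a b c : A) : - bqf_mk a b c = bqf_mk (- a) (- b) (- c).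
Proof. by apply/rowP => -[[|[|[|//]]] ?]; rewrite !mxE. Qed.

Lemma bqf_mkD (A : nmodType) (a b c a' b' c' : A) :
  bqf_mk a b c + bqf_mk a' b' c' = bqf_mk (a + a') (b + b') (c + c').
Proof. by apply/rowP => -[[|[|[|//]]] ?]; rewrite !mxE. Qed.

Lemma bqf_mkZ (A : pzRingType) (t a b c : A) :
  t *: bqf_mk a b c = bqf_mk (t * a) (t * b) (t * c).
Proof. by apply/rowP => -[[|[|[|//]]] ?]; rewrite !mxE. Qed.

Lemma map_bqf_mk (A B : zmodType) (f : {additive A -> B}) (a b c : A) :
  map_mx f (bqf_mk a b c) = bqf_mk (f a) (f b) (f c).
Proof. by apply/rowP => -[[|[|[|//]]] ?]; rewrite !mxE. Qed.

(** The product of the linear forms [x X + y Y] and [r X + s Y]. *)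
Definition lin_mul (A : pzRingType) (x y r s : A) : bqf A :=
  bqf_mk (x * r) (x * s + y * r) (y * s).

Lemma disc_lin_mul (A : comPzRingType) (x y r s : A) :
  disc (lin_mul x y r s) = (x * s - y * r) ^+ 2.
Proof. by rewrite disc_bqf_mk; ring. Qed.

(** The integral matrix with rows [(a, m)] and [(n, c)] is singular, so its
    nonzero row divided by its gcd spans the lattice of which both rows are
    multiples. *)
Lemma rank_one_factorization (a m n c : int) : a * c = m * n ->
  [|| a != 0, m != 0, n != 0 | c != 0] ->
  exists x y r s u v : int,
    [/\ u * x + v * y = 1, a = x * r, m = y * r, n = x * s & c = y * s].
Proof.
have prim (a' m' : int) : (a' != 0) || (m' != 0) -> exists x y g u v : int,
    [/\ u * x + v * y = 1, a' = x * g, m' = y * g & g != 0].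
  move=> nz; have [u [v E]] := Bezoutz a' m'.
  have g0 : gcdz a' m' != 0 by rewrite gcdz_eq0 negb_and.
  have /dvdzP[x xE] := dvdz_gcdl a' m'; have /dvdzP[y yE] := dvdz_gcdr a' m'.
  exists x, y, (gcdz a' m'), u, v; split=> //.
  apply: (mulIf g0); rewrite mul1r; move: xE yE E.
  by move: (gcdz a' m') => g xE yE; rewrite xE yE => E; rewrite -[RHS]E; ring.
move=> acmn nz; have [nz1|] := boolP ((a != 0) || (m != 0)).
  have [x [y [g [u [v [uv aE mE g0]]]]]] := prim a m nz1.
  have xcyn : x * c = y * n.
    by apply: (mulIf g0); rewrite mulrAC -aE acmn mE; ring.
  exists x, y, g, (u * n + v * c), u, v; split=> //.
    move: (congr1 ( *%R^~ n) uv) (congr1 ( *%R v) xcyn) => /=; lia.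
  move: (congr1 ( *%R^~ c) uv) (congr1 ( *%R u) xcyn) => /=; lia.
rewrite negb_or !negbK => /andP[/eqP a0 /eqP m0].
have [|x [y [g [u [v [uv nE cE g0]]]]]] := prim n c.
  by move: nz; rewrite a0 m0 !eqxx.
by exists x, y, 0, g, u, v; rewrite !mulr0.
Qed.

(** With [b = 2 m + k], the condition on the discriminant says
    [a c = m (m + k)], that is, the matrix with rows [(a, m)] and [(m + k, c)]
    has rank one; its entries are then the products of the coordinates of the
    two linear factors, in the order that makes the determinant [+ k]. *)
Lemma bqf_factorization (k : int) (q : bqf int) : k != 0 -> disc q = k ^+ 2 ->
  exists x y r s u v : int,
    [/\ u * x + v * y = 1, x * s - y * r = k & q = lin_mul x y r s].
Proof.
move=> k0; rewrite [q in disc q]bqf_mkE disc_bqf_mk => dq.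
set a := bqf_a q in dq *; set b := bqf_b q in dq *; set c := bqf_c q in dq *.
have [m bE] : exists m : int, b = 2 * m + k.
  exists ((b - k) %/ 2)%Z.
  have := divz_eq (b - k) 2; have : (0 <= (b - k) %% 2 < 2)%Z by rewrite modz_ge0 // ltz_pmod.
  move: ((b - k) %/ 2)%Z ((b - k) %% 2)%Z => e f f2 bkE.
  have [f0|f1] : f = 0 \/ f = 1 by lia.
    lia.
  (* An odd [b - k] would make [4 a c = (b - k) (b + k)] odd. *)
  have bE : b = k + e * 2 + 1 by lia.
  by exfalso; move: dq; rewrite bE; clear -f; nia.
have acm : a * c = m * (m + k) by move: dq; rewrite bE; nia.
have [|x [y [r [s [u [v [uv aE mE nE cE]]]]]]] := rank_one_factorization acm.
  by apply/or4P; have [->|m0] := eqVneq m 0; [apply: Or43; rewrite add0r|apply: Or42].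
exists x, y, r, s, u, v; split=> //; first by rewrite -mE -nE; ring.
rewrite [LHS]bqf_mkE -/a -/b -/c /lin_mul -aE -cE -nE -mE bE; congr bqf_mk; ring.
Qed.

(** The product and the determinant of two linear forms determine the four
    products of their coordinates, that is, a matrix of rank one, which in turn
    determines its primitive factor up to sign. *)
Lemma lin_mul_inj (k x y r s u v x' y' r' s' u' v' : int) : k != 0 ->
  u * x + v * y = 1 -> u' * x' + v' * y' = 1 ->
  x * s - y * r = k -> x' * s' - y' * r' = k ->
  lin_mul x y r s = lin_mul x' y' r' s' ->
  exists2 e : int, e ^+ 2 = 1 & [/\ x' = e * x, y' = e * y, r' = e * r & s' = e * s].
Proof.
move=> k0 uv uv' d d' /bqf_mk_inj[Ea Eb Ec].
have Exs : x * s = x' * s' by lia.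
have Eyr : y * r = y' * r' by lia.
set e := u' * x + v' * y.
have rE : r' = e * r.
  move: (congr1 ( *%R^~ r') uv') (congr1 ( *%R u') Ea) (congr1 ( *%R v') Eyr).
  by rewrite /e /=; lia.
have sE : s' = e * s.
  move: (congr1 ( *%R^~ s') uv') (congr1 ( *%R u') Exs) (congr1 ( *%R v') Ec).
  by rewrite /e /=; lia.
have xE : x = e * x'.
  apply: (mulIf k0); rewrite -[in LHS]d' -[in RHS]d.
  move: (congr1 ( *%R (e * y')) Ea) (congr1 ( *%R (e * x')) Eyr).
  by rewrite /= rE sE; clear; lia.
have yE : y = e * y'.
  apply: (mulIf k0); rewrite -[in LHS]d' -[in RHS]d.
  move: (congr1 ( *%R (e * y')) Exs) (congr1 ( *%R (e * x')) Ec).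
  by rewrite /= rE sE; clear; lia.
have e2 : e ^+ 2 = 1.
  have : e * (u * x' + v * y') = 1 by rewrite -uv [in RHS]xE [in RHS]yE; ring.
  move=> ef; have : (e %| 1)%Z by apply/dvdzP; exists (u * x' + v * y'); rewrite mulrC.
  by rewrite dvdz1 => /eqP e1; have [->|->] : e = 1 \/ e = -1 by lia.
by exists e => //; split=> //; [rewrite xE | rewrite yE]; rewrite mulrA -expr2 e2 mul1r.
Qed.

(** Changing the sign of [q] changes that of the determinant, so the factors are
    exchanged: the second root of [q] is the first root of [- q].  When
    [(x', y')] is primitive as well, [h] is the content of [q] up to sign. *)
Lemma lin_mul_opp (k x y r s u v x' y' r' s' : int) :
  u * x + v * y = 1 ->
  x * s - y * r = k -> x' * s' - y' * r' = k ->
  lin_mul x y r s = - lin_mul x' y' r' s' ->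
  exists h, [/\ r = h * x', s = h * y' & k = h * (x * y' - y * x')].
Proof.
move=> uv d d'; rewrite bqf_mkN => /bqf_mk_inj[Ea Eb Ec].
have Exs : x * s = - (y' * r') by lia.
have Eyr : y * r = - (x' * s') by lia.
exists (- (u * r' + v * s')).
have rE : r = - (u * r' + v * s') * x'.
  move: (congr1 ( *%R^~ r) uv) (congr1 ( *%R u) Ea) (congr1 ( *%R v) Eyr) => /=; lia.
have sE : s = - (u * r' + v * s') * y'.
  move: (congr1 ( *%R^~ s) uv) (congr1 ( *%R u) Exs) (congr1 ( *%R v) Ec) => /=; lia.
by split=> //; rewrite -d {1}rE {1}sE; ring.
Qed.

(** * Primitive vectors modulo sign *)

Definition sup_norm_eq (x y : int) (P : nat) : Prop :=
  (`|x| <= P /\ `|y| <= P /\ (P <= `|x| \/ P <= `|y|))%N.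

(** Any complement can be reduced modulo the larger coordinate of [(x, y)]. *)
Lemma small_complement (x y u v : int) (P : nat) :
  u * x + v * y = 1 -> sup_norm_eq x y P ->
  exists r s : int, [/\ x * s - y * r = 1, (`|r| <= P)%N & (`|s| <= P)%N].
Proof.
have key (a b u' v' : int) : u' * a + v' * b = 1 -> (`|b| <= `|a|)%N ->
    exists r s : int, [/\ a * s - b * r = 1, (`|r| <= `|a|)%N & (`|s| <= `|a|)%N].
  move=> E ba.
  have a0 : a != 0.
    apply/eqP => a0; have b0 : b = 0 by lia.
    by move: E; rewrite a0 b0; lia.
  pose r := (- v' %% a)%Z; pose w := (- v' %/ a)%Z.
  have r0 : 0 <= r by rewrite modz_ge0.
  have ra : r < `|a| by rewrite ltz_mod.
  have vE : - v' = w * a + r := divz_eq _ _.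
  exists r, (u' - b * w).
  have D : a * (u' - b * w) - b * r = 1.
    by rewrite -E -[v' in RHS]opprK vE; ring.
  split=> //; first by lia.
  move: (u' - b * w) D => s D.
  have : `|a * s| <= 1 + `|b| * `|r|.
    by rewrite -normrM; move: (b * r) (a * s) D; clear; lia.
  rewrite normrM; clear -a0 r0 ra ba.
  have : 0 < `|a| by rewrite normr_gt0.
  have : `|b| <= `|a| by lia.
  rewrite (ger0_norm r0) => bA A0 sE.
  have : `|a| * `|s| <= `|a| * `|a| by nia.
  by rewrite ler_pM2l //; lia.
move=> E [xP [yP [Px|Py]]].
  have [|r [s [D rx sx]]] := key _ _ _ _ E; first by lia.
  by exists r, s; split=> //; lia.
have [||r [s [D rx sx]]] := key y x v u; [by rewrite addrC|by lia|].
exists (- s), (- r); split; [rewrite -D; ring | lia | lia].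
Qed.

Lemma coprime_bezout (p j : nat) :
  coprime p j <-> exists u v : int, u * p%:Z + v * j%:Z = 1.
Proof.
split=> [cpj|[u [v E]]].
  by have /coprimezP[[u v] /= E] : coprimez p j by []; exists u, v.
by rewrite -[coprime p j]/(coprimez p j); apply/coprimezP; exists (u, v).
Qed.

(** For [1 <= j <= 2 p] these vectors run through one half of the boundary of
    the square of side [2 p] centred at the origin: of each vector of sup norm
    [p] and its opposite, exactly one occurs, and only once.  One coordinate is
    [p] and the other is congruent to [j] or [- j] modulo [p], so that the
    primitive vectors correspond to the [j] coprime to [p]. *)
Definition prim_vec (b : bool) (p j : nat) : int * int :=
  if b then (p%:Z, j%:Z - p%:Z) else (p%:Z - j%:Z, p%:Z).

Lemma prim_vec_sup b p j : (0 < j <= 2 * p)%N ->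
  sup_norm_eq (prim_vec b p j).1 (prim_vec b p j).2 p.
Proof. by case: b; rewrite /sup_norm_eq /=; lia. Qed.

Lemma prim_vec_bezout b p j : coprime p j ->
  exists u v : int, u * (prim_vec b p j).1 + v * (prim_vec b p j).2 = 1.
Proof.
move=> /coprime_bezout[u [v E]]; case: b => /=.
  by exists (u + v), v; rewrite -E; ring.
by exists (- v), (u + v); rewrite -E; ring.
Qed.

Lemma prim_vec_surj (x y u v : int) (P : nat) : u * x + v * y = 1 ->
  sup_norm_eq x y P -> exists (e : int) b j,
  [/\ e ^+ 2 = 1, (0 < P)%N, (0 < j <= 2 * P)%N, coprime P j
    & prim_vec b P j = (e * x, e * y)].
Proof.
move=> uv [xP [yP xyP]].
have P0 : (0 < P)%N.
  case: P xP yP {xyP} => // xP yP; move: uv.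
  have -> : x = 0 by lia.
  have -> : y = 0 by lia.
  lia.
have [xPe|[xPe|[yPe|yPe]]] : (x = P%:Z /\ - P%:Z < y) \/ (x = - P%:Z /\ y < P%:Z) \/
    (y = P%:Z /\ x < P%:Z) \/ (y = - P%:Z /\ - P%:Z < x) by lia.
- exists 1, true, (absz (y + P%:Z)); split=> //; first lia.
    apply/coprime_bezout; exists (u - v), v; rewrite -uv; case: xPe => -> _.
    by rewrite gez0_abs; [ring | lia].
  by rewrite /prim_vec; congr pair; lia.
- exists (-1), true, (absz (P%:Z - y)); split=> //; first lia.
    apply/coprime_bezout; exists (v - u), (- v); rewrite -uv; case: xPe => -> _.
    by rewrite gez0_abs; [ring | lia].
  by rewrite /prim_vec; congr pair; lia.
- exists 1, false, (absz (P%:Z - x)); split=> //; first lia.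
    apply/coprime_bezout; exists (u + v), (- u); rewrite -uv; case: yPe => -> _.
    by rewrite gez0_abs; [ring | lia].
  by rewrite /prim_vec; congr pair; lia.
- exists (-1), false, (absz (P%:Z + x)); split=> //; first lia.
    apply/coprime_bezout; exists (- u - v), u; rewrite -uv; case: yPe => -> _.
    by rewrite gez0_abs; [ring | lia].
  by rewrite /prim_vec; congr pair; lia.
Qed.

Lemma prim_vec_inj (e : int) b p j b' p' j' : e ^+ 2 = 1 ->
  (0 < j <= 2 * p)%N -> (0 < j' <= 2 * p')%N ->
  prim_vec b' p' j' = (e * (prim_vec b p j).1, e * (prim_vec b p j).2) ->
  e = 1 /\ (b, p, j) = (b', p', j').
Proof.
move=> /eqP; rewrite sqrf_eq1 => /orP[] /eqP -> hj hj'.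
  move: b b' => [] [] /= [E1 E2]; split=> //; try (exfalso; lia).
    by congr (_, _, _); lia.
  by congr (_, _, _); lia.
by move: b b' => [] [] /= [E1 E2]; exfalso; lia.
Qed.

(** * The progression of forms with a given root *)

Definition root_index : Type := bool * nat * nat.

Definition roots_upto (n : nat) : seq root_index :=
  [seq (b, pj.1, pj.2) | pj <- [seq (p, j) | p <- iota 1 n,
                                j <- [seq j <- iota 1 (2 * p) | coprime p j]],
                         b <- [:: true; false]].

Definition root_vec (i : root_index) : int * int := prim_vec i.1.1 i.1.2 i.2.

Lemma mem_roots_upto n b p j : ((b, p, j) \in roots_upto n) =
  [&& (0 < p <= n)%N, (0 < j <= 2 * p)%N & coprime p j].
Proof.
apply/allpairsP/idP => [[[[p' j'] b'] /= [/allpairsPdep[p'' [j'' [hp hj [-> ->]]]] _]]|].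
  case=> _ -> ->; move: hp hj; rewrite mem_filter !mem_iota => hp /andP[-> hj].
  by apply/and3P; split=> //; lia.
case/and3P => hp hj cpj; exists ((p, j), b) => /=; split; last 2 first.
- by case: b.
- by [].
apply/allpairsPdep; exists p, j; rewrite mem_filter !mem_iota cpj.
by split=> //; lia.
Qed.

Lemma uniq_roots_upto n : uniq (roots_upto n).
Proof.
apply: allpairs_uniq => //; last by move=> [[p j] b] [[p' j'] b'] _ _ /= [-> -> ->].
apply: allpairs_uniq_dep; first exact: iota_uniq.
  by move=> p _; rewrite filter_uniq ?iota_uniq.
by move=> [p j] [p' j'] _ _ /= [-> ->].
Qed.

Lemma sum_roots_upto (V : nmodType) (phi : root_index -> V) n :
  \sum_(i <- roots_upto n) phi i =
  \sum_(1 <= p < n.+1) \sum_(1 <= j < (2 * p).+1 | coprime p j)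
    (phi (true, p, j) + phi (false, p, j)).
Proof.
rewrite big_allpairs_dep /= big_allpairs_dep /= /index_iota subn1 /=.
apply: eq_bigr => p _; rewrite big_filter subn1 /=; apply: eq_bigr => j _.
by rewrite !big_cons big_nil addr0.
Qed.

Lemma size_roots_upto n : (size (roots_upto n) <= 4 * n ^ 2)%N.
Proof.
rewrite -sum1_size sum_roots_upto.
apply: (@leq_trans (\sum_(1 <= p < n.+1) 4 * n)).
  rewrite [X in (X <= _)%N]big_nat [X in (_ <= X)%N]big_nat leq_sum // => p /andP[_ pn].
  rewrite big_mkcond; apply: (@leq_trans (\sum_(1 <= j < (2 * p).+1) 2)).
    by apply: leq_sum => j _; case: ifP.
  by rewrite sum_nat_const_nat; lia.
by rewrite sum_nat_const_nat; lia.
Qed.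

Lemma card_fset_set_le (T : choiceType) (Q : set T) (s : seq T) :
  (forall q, Q q -> q \in s) -> finite_set Q /\ (#|` fset_set Q| <= size s)%N.
Proof.
move=> Qs; have fQ : finite_set Q.
  by apply: sub_finite_set (finite_seq s) => q /Qs.
split=> //; apply: uniq_leq_size; first exact: fset_uniq.
by move=> q; rewrite in_fset_set // => /set_mem /Qs.
Qed.

Lemma card_fset_set_ge (T : choiceType) (Q : set T) (s : seq T) : finite_set Q ->
  uniq s -> (forall q, q \in s -> Q q) -> (size s <= #|` fset_set Q|)%N.
Proof.
move=> fQ us sQ; apply: uniq_leq_size => // q /sQ Qq.
by rewrite in_fset_set //; apply/mem_set.
Qed.

(** [w i] completes the primitive vector [root_vec i] to a basis of determinant
    [1], without being longer. *)
Definition is_complement (w : root_index -> int * int) : Prop :=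
  forall b p j, (0 < j <= 2 * p)%N -> coprime p j ->
  [/\ (root_vec (b, p, j)).1 * (w (b, p, j)).2 - (root_vec (b, p, j)).2 * (w (b, p, j)).1 = 1,
      (absz (w (b, p, j)).1 <= p)%N & (absz (w (b, p, j)).2 <= p)%N].

Lemma complement_exists : exists w, is_complement w.
Proof.
have /choice[w Hw] (i : root_index) : exists w : int * int,
    (0 < i.2 <= 2 * i.1.2)%N -> coprime i.1.2 i.2 ->
    [/\ (root_vec i).1 * w.2 - (root_vec i).2 * w.1 = 1,
      (absz w.1 <= i.1.2)%N & (absz w.2 <= i.1.2)%N].
  case: i => [[b p] j] /=.
  have [/andP[hj cpj]|] := boolP ((0 < j <= 2 * p)%N && coprime p j); last first.
    by rewrite negb_and => /orP[] /negbTE ->; exists (0, 0).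
  have [u [v E]] := prim_vec_bezout b cpj.
  have [r [s [D rP sP]]] := small_complement E (prim_vec_sup b hj).
  by exists (r, s).
by exists w => b p j; exact: (Hw (b, p, j)).
Qed.

(** The product of [v] and [t v + k u], where [u] is the complement of [v]. *)
Definition root_form (k : nat) (w : root_index -> int * int) (i : root_index) (t : int) :
    bqf int :=
  lin_mul (root_vec i).1 (root_vec i).2
    (t * (root_vec i).1 + k%:Z * (w i).1) (t * (root_vec i).2 + k%:Z * (w i).2).

(** The real form [v^2], the step of the progression [root_form k w i]. *)
Definition root_sqr (R : realType) (i : root_index) : 'rV[R]_3 :=
  map_mx intr (lin_mul (root_vec i).1 (root_vec i).2 (root_vec i).1 (root_vec i).2).

Lemma bqf_norm_root_form (R : realType) (N : 'rV[R]_3 -> R) k w i t :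
  bqf_norm N (root_form k w i t) =
  N (t%:~R *: root_sqr R i + k%:R *:
     map_mx intr (lin_mul (root_vec i).1 (root_vec i).2 (w i).1 (w i).2)).
Proof.
rewrite /bqf_norm /root_sqr /root_form /lin_mul !map_bqf_mk !bqf_mkZ bqf_mkD.
congr (N (bqf_mk _ _ _)); rewrite ?(rmorphM, rmorphD) /=; ring.
Qed.

Lemma disc_root_form k w b p j t : is_complement w -> (0 < j <= 2 * p)%N ->
  coprime p j -> disc (root_form k w (b, p, j) t) = k%:Z ^+ 2.
Proof.
move=> hw hj cpj; have [D _ _] := hw b p j hj cpj; rewrite disc_lin_mul.
by congr (_ ^+ 2); rewrite -[RHS]mulr1 -D; ring.
Qed.

(** Along the progression of forms with a given root [v] the norm is
    [|t| N(v^2)], with an error at most [M N(v^2)]: a bounded error on [t]. *)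
Definition norm_progression (R : realType) (N : 'rV[R]_3 -> R) (k : nat)
    (w : root_index -> int * int) (M : R) : Prop :=
  forall b p j, (0 < j <= 2 * p)%N -> coprime p j ->
  0 < N (root_sqr R (b, p, j)) /\
  forall t, `|bqf_norm N (root_form k w (b, p, j) t) -
     (absz t)%:R * N (root_sqr R (b, p, j))| <= M * N (root_sqr R (b, p, j)).

(** [N(v^2)] has the order of the squared sup norm of [v], and so does at most
    [N(k v u)], because [u] is not longer than [v]. *)
Lemma norm_progression_exists (R : realType) (N : 'rV[R]_3 -> R) (hN : is_norm N) (k : nat) w :
  is_complement w -> exists2 M, 0 <= M & norm_progression N k w M.
Proof.
move=> hw; have [c c0 cN] := is_norm_ge_sup hN; have [C C0 NC] := is_norm_le_sup hN.
exists (2 * C * k%:R / c); first by rewrite divr_ge0 ?mulr_ge0 // ltW.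
move=> b p j hj cpj; have [_ rP sP] := hw b p j hj cpj.
have [xP [yP xyP]] : sup_norm_eq (root_vec (b, p, j)).1 (root_vec (b, p, j)).2 p :=
  prim_vec_sup b hj.
set x := (root_vec _).1 in xP xyP *; set y := (root_vec _).2 in yP xyP *.
set r := (w _).1 in rP *; set s := (w _).2 in sP *.
have F0 : c * p%:R ^+ 2 <= N (root_sqr R (b, p, j)).
  apply: le_trans (cN _); rewrite ler_pM2l //.
  have [V0 _ V2] := bqf_mkK ((x * x)%:~R : R) (x * y + y * x)%:~R (y * y)%:~R.
  have sq (z : int) : (p <= absz z)%N -> p%:R ^+ 2 <= `|(z * z)%:~R| :> R.
    move=> pz; rewrite -intr_norm -[p%:R]/(p%:Z%:~R) -rmorphXn /= ler_int; nia.
  by case: xyP => /sq h; apply: le_trans h _; [rewrite -V0 | rewrite -V2];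
    rewrite /root_sqr /lin_mul map_bqf_mk; exact: row_coord_le_norm.
split=> [|t].
  by apply: lt_le_trans F0; rewrite mulr_gt0 // exprn_gt0 // ltr0n; lia.
rewrite bqf_norm_root_form.
rewrite (_ : (absz t)%:R = `|t%:~R : R|); last by rewrite -intr_norm -abszE -pmulrn.
rewrite -(is_norm_homogeneous hN).
apply: le_trans (is_norm_dist hN _ _) _; rewrite addrAC subrr add0r.
rewrite (is_norm_homogeneous hN) normr_nat.
apply: le_trans (_ : k%:R * (C * (2 * p%:R ^+ 2)) <= _).
  rewrite ler_wpM2l //; apply: le_trans (NC _) _; rewrite ler_pM2l //.
  apply: row_norm_le; first by rewrite mulr_ge0 ?exprn_ge0.
  have z2 (z : int) : (absz z <= 2 * p ^ 2)%N -> `|z%:~R : R| <= 2 * p%:R ^+ 2.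
    move=> zp; rewrite -intr_norm (_ : 2 * p%:R ^+ 2 = (2 * p ^ 2)%N%:Z%:~R) ?ler_int; first lia.
    by rewrite -[RHS]/((2 * p ^ 2)%:R) natrM natrX.
  rewrite /lin_mul map_bqf_mk => -[[|[|[|//]]] ?]; rewrite mxE /=; apply: z2; nia.
rewrite (_ : _ / c * _ = 2 * C * k%:R * (N (root_sqr R (b, p, j)) / c)); last by field; lra.
rewrite (_ : k%:R * _ = 2 * C * k%:R * p%:R ^+ 2); last by ring.
by rewrite ler_wpM2l ?mulr_ge0 // ?(ltW C0) // ler_pdivlMr // mulrC.
Qed.

(** * Small roots *)

Definition near_ints (S : nat) : seq int := [seq l%:Z - S%:Z | l <- iota 0 (2 * S).+1].

Definition far_ints (m S : nat) : seq int :=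
  [seq (m + l).+1%:Z | l <- iota 0 S] ++ [seq - (m + l).+1%:Z | l <- iota 0 S].

Lemma mem_near_ints S (t : int) : (absz t <= S)%N -> t \in near_ints S.
Proof.
move=> tS; apply/mapP; exists (absz (t + S%:Z)); last by lia.
by rewrite mem_iota; lia.
Qed.

Lemma mem_far_ints m S (t : int) : t \in far_ints m S -> (m < absz t <= m + S)%N.
Proof.
by rewrite mem_cat => /orP[] /mapP[l]; rewrite mem_iota => hl ->; lia.
Qed.

Lemma uniq_far_ints m S : uniq (far_ints m S).
Proof.
rewrite cat_uniq !map_inj_uniq ?iota_uniq => [|l l' H|l l' H]; try lia.
rewrite andbT; apply/hasPn => _ /mapP[l _ ->]; apply/mapP => -[l' _]; lia.
Qed.

(** The second factor is a multiple of the second root, so the product of the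
    sup norms of the roots is at most the absolute value of one of [x r], [x s],
    [y r], [y s].  The first and the last are coefficients of the form; the other
    two have the middle coefficient as sum and [k] as difference. *)
Lemma roots_product_bound (x y r s u v x' y' r' s' : int) (k P P' : nat) :
  (0 < k)%N -> u * x + v * y = 1 ->
  x * s - y * r = k%:Z -> x' * s' - y' * r' = k%:Z ->
  sup_norm_eq x y P -> sup_norm_eq x' y' P' ->
  lin_mul x y r s = - lin_mul x' y' r' s' ->
  [\/ (P * P' <= absz (x * r)%R + k)%N, (P * P' <= absz (x * s + y * r)%R + k)%N
    | (P * P' <= absz (y * s)%R + k)%N].
Proof.
move=> k0 uv d d' [_ [_ xyP]] [_ [_ xyP']] E.
have [h [rE sE kE]] := lin_mul_opp uv d d' E.
have h0 : (0 < absz h)%N by rewrite absz_gt0; apply/eqP => h0; move: kE; rewrite h0; lia.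
have big (a b : int) : (P <= absz a)%N -> (P' <= absz b)%N ->
    (P * P' <= absz (a * (h * b))%R)%N.
  by move=> Pa Pb; rewrite !abszM leq_mul // -[P']mul1n leq_mul.
case: xyP xyP' => [Px|Py] [Px'|Py'].
- by apply: Or31; have := big _ _ Px Px'; rewrite -rE; lia.
- by apply: Or32; have := big _ _ Px Py'; rewrite -sE; lia.
- by apply: Or32; have := big _ _ Py Px'; rewrite -rE; lia.
- by apply: Or33; have := big _ _ Py Py'; rewrite -sE; lia.
Qed.

(** If [det(v, u) = 1] then [w = det(w, u) v + det(v, w) u].  The sign [e] turns
    [v] into the representative of its class modulo sign, and [w] accordingly. *)
Lemma root_form_of_factor (k n : nat) w (x y r s u v : int) P : is_complement w ->
  u * x + v * y = 1 -> sup_norm_eq x y P -> (P <= n)%N -> x * s - y * r = k%:Z ->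
  exists2 i, i \in roots_upto n & exists t, lin_mul x y r s = root_form k w i t.
Proof.
move=> hw uv xyP Pn d; have [e [b [j [e2 P0 hj cpj vE]]]] := prim_vec_surj uv xyP.
exists (b, P, j); first by rewrite mem_roots_upto P0 Pn hj.
have [D _ _] := hw b P j hj cpj; rewrite /root_form.
move: D; rewrite /root_vec /= vE /=; move: (w _).1 (w _).2 => u1 u2 D.
exists (e * r * u2 - e * s * u1).
have E1 : e * r = (e * r * u2 - e * s * u1) * (e * x) + k%:Z * u1.
  rewrite -d [LHS](_ : _ = e * r * (e * x * u2 - e * y * u1)); last by rewrite D mulr1.
  transitivity ((e * r * u2 - e * s * u1) * (e * x) + e ^+ 2 * (x * s - y * r) * u1).
    by ring.
  by rewrite e2 mul1r.
have E2 : e * s = (e * r * u2 - e * s * u1) * (e * y) + k%:Z * u2.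
  rewrite -d [LHS](_ : _ = e * s * (e * x * u2 - e * y * u1)); last by rewrite D mulr1.
  transitivity ((e * r * u2 - e * s * u1) * (e * y) + e ^+ 2 * (x * s - y * r) * u2).
    by ring.
  by rewrite e2 mul1r.
rewrite -E1 -E2 /lin_mul; congr bqf_mk; rewrite -[LHS]mul1r -e2; ring.
Qed.

Lemma sup_norm_exists (x y : int) : exists P, sup_norm_eq x y P.
Proof. by exists (maxn (absz x) (absz y)); rewrite /sup_norm_eq; lia. Qed.

(** The sup norms of the two roots have a product less than [(n + 1)^2], so one of
    them is at most [n]; the second root of [q] is the first root of [- q]. *)
Lemma small_root_exists (k n : nat) w (q : bqf int) : is_complement w -> (0 < k)%N ->
  disc q = k%:Z ^+ 2 ->
  (absz (bqf_a q) + k < n.+1 ^ 2)%N -> (absz (bqf_b q) + k < n.+1 ^ 2)%N ->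
  (absz (bqf_c q) + k < n.+1 ^ 2)%N ->
  exists2 i, i \in roots_upto n &
    exists t, q = root_form k w i t \/ - q = root_form k w i t.
Proof.
move=> hw k0 dq; rewrite [q in X in X -> _]bqf_mkE.
have kz : k%:Z != 0 by lia.
have dq' : disc (- q) = k%:Z ^+ 2.
  by rewrite -dq [q]bqf_mkE bqf_mkN !disc_bqf_mk; ring.
have [x [y [r [s [u [v [uv d qE]]]]]]] := bqf_factorization kz dq.
have [x' [y' [r' [s' [u' [v' [uv' d' qE']]]]]]] := bqf_factorization kz dq'.
have [P xyP] := sup_norm_exists x y; have [P' xyP'] := sup_norm_exists x' y'.
have E : lin_mul x y r s = - lin_mul x' y' r' s' by rewrite -qE -qE' opprK.
have PP := roots_product_bound k0 uv d d' xyP xyP' E.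
have [Ea Eb Ec] := bqf_mkK (x * r) (x * s + y * r) (y * s).
rewrite -bqf_mkE qE /bqf_a /bqf_b /bqf_c /lin_mul Ea Eb Ec => an bn cn.
have PPn : (P * P' < n.+1 ^ 2)%N by case: PP; lia.
have [Pn|nP] := leqP P n.
  have [i hi [t tE]] := root_form_of_factor hw uv xyP Pn d.
  by exists i => //; exists t; left.
have P'n : (P' <= n)%N by nia.
have [i hi [t tE]] := root_form_of_factor hw uv' xyP' P'n d'.
by exists i => //; exists t; right; rewrite -tE -qE' qE.
Qed.

Lemma root_form_inj (k : nat) w (b b' : bool) (p p' j j' : nat) (t t' : int) :
  is_complement w -> (0 < k)%N ->
  (0 < j <= 2 * p)%N -> coprime p j -> (0 < j' <= 2 * p')%N -> coprime p' j' ->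
  root_form k w (b, p, j) t = root_form k w (b', p', j') t' ->
  (b, p, j) = (b', p', j') /\ t = t'.
Proof.
move=> hw k0 hj cpj hj' cpj' E.
have [D _ _] := hw b p j hj cpj; have [D' _ _] := hw b' p' j' hj' cpj'.
have [u [v uv]] := prim_vec_bezout b cpj; have [u' [v' uv']] := prim_vec_bezout b' cpj'.
have kz : k%:Z != 0 by lia.
have [||e e2 [xE yE rE sE]] := lin_mul_inj kz uv uv' _ _ E.
- by rewrite -[RHS]mulr1 -D /root_vec; ring.
- by rewrite -[RHS]mulr1 -D' /root_vec; ring.
have [|e1 idx] := @prim_vec_inj e b p j b' p' j' e2 hj hj'.
  by rewrite -xE -yE; case: (prim_vec b' p' j').
split=> //; move: rE sE; rewrite e1 !mul1r -idx => /addIr rE /addIr sE.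
have : (root_vec (b, p, j)).1 * (t' - t) = 0 by rewrite mulrBr mulrC rE mulrC subrr.
have : (root_vec (b, p, j)).2 * (t' - t) = 0 by rewrite mulrBr mulrC sE mulrC subrr.
move: uv; rewrite -/(root_vec (b, p, j)).
move: (root_vec (b, p, j)).1 (root_vec (b, p, j)).2 => x y uv.
move=> y0 x0; apply/esym/subr0_eq; rewrite -[LHS]mul1r -uv mulrDl -!mulrA x0 y0; ring.
Qed.

(** For [|t| > 2 k] the second factor [t v + k u] is more than [k] times as long
    as [v].  It is a multiple, by a divisor of [k], of the second root, which is
    therefore strictly longer than the first root.  This cannot hold for both
    [q] and [- q], as they have the same roots in opposite order. *)
Lemma root_form_far_opp (k : nat) w (b b' : bool) (p p' j j' : nat) (t t' : int) :
  is_complement w -> (0 < k)%N ->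
  (0 < j <= 2 * p)%N -> coprime p j -> (0 < j' <= 2 * p')%N -> coprime p' j' ->
  (2 * k < absz t)%N -> (2 * k < absz t')%N ->
  root_form k w (b, p, j) t <> - root_form k w (b', p', j') t'.
Proof.
move=> hw k0 hj cpj hj' cpj' tk tk' E.
have [D rp sp] := hw b p j hj cpj; have [D' rp' sp'] := hw b' p' j' hj' cpj'.
have [u [v uv]] := prim_vec_bezout b cpj; have [u' [v' uv']] := prim_vec_bezout b' cpj'.
have E' : root_form k w (b', p', j') t' = - root_form k w (b, p, j) t by rewrite E opprK.
move: (prim_vec_sup b hj) (prim_vec_sup b' hj') uv uv' D D' rp sp rp' sp' E E'.
rewrite /root_form -/(root_vec (b, p, j)) -/(root_vec (b', p', j')).
move: (root_vec (b, p, j)).1 (root_vec (b, p, j)).2 => x y.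
move: (root_vec (b', p', j')).1 (root_vec (b', p', j')).2 => x' y'.
move: (w (b, p, j)).1 (w (b, p, j)).2 => r s.
move: (w (b', p', j')).1 (w (b', p', j')).2 => r' s'.
have main (a c e f g h z l : int) (q q' : nat) : (0 < q)%N -> sup_norm_eq a c q ->
    (absz e <= q)%N -> (absz f <= q)%N -> (2 * k < absz z)%N ->
    (absz g <= q')%N -> (absz h <= q')%N -> (absz l <= k)%N ->
    z * a + k%:Z * e = l * g -> z * c + k%:Z * f = l * h -> (k * q < k * q')%N.
  move=> q0 [_ [_ acq]] eq_ fq zk gq hq lk E1 E2.
  have bd (m m' d : int) : (q <= absz m)%N -> (absz m' <= q)%N -> (absz d <= q')%N ->
      z * m + k%:Z * m' = l * d -> (k * q < k * q')%N.
    move=> qm m'q dq' El.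
    have ub : (absz (l * d)%R <= k * q')%N by rewrite abszM leq_mul.
    have lb : ((2 * k).+1 * q <= absz (z * m)%R)%N by rewrite abszM leq_mul.
    have kb : (absz (k%:Z * m')%R <= k * q)%N by rewrite abszM leq_mul.
    apply: leq_trans ub; rewrite -El.
    move: lb kb; rewrite mulSn -mulnA; move: (z * m) (k%:Z * m') (k * q)%N => zm km kq.
    by clear -q0; lia.
  by case: acq => [qa|qc]; [exact: bd qa eq_ gq E1 | exact: bd qc fq hq E2].
have hk (h m : int) : k%:Z = h * m -> (absz h <= k)%N.
  move=> kE; have := congr1 absz kE; rewrite abszM /= => ->.
  by rewrite leq_pmulr // absz_gt0; apply/eqP => m0; move: kE; rewrite m0; lia.
move=> sup sup' uv uv' D D' rp sp rp' sp' E E'.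
have d : x * (t * y + k%:Z * s) - y * (t * x + k%:Z * r) = k%:Z.
  by rewrite -[RHS]mulr1 -D; ring.
have d' : x' * (t' * y' + k%:Z * s') - y' * (t' * x' + k%:Z * r') = k%:Z.
  by rewrite -[RHS]mulr1 -D'; ring.
have [h [E1 E2 /hk hh]] := lin_mul_opp uv d d' E.
have [h' [E1' E2' /hk hh']] := lin_mul_opp uv' d' d E'.
have [xp [yp _]] := sup; have [xp' [yp' _]] := sup'.
have p0 : (0 < p)%N by lia.
have p0' : (0 < p')%N by lia.
have := main _ _ _ _ _ _ _ _ _ _ p0 sup rp sp tk xp' yp' hh E1 E2.
have := main _ _ _ _ _ _ _ _ _ _ p0' sup' rp' sp' tk' xp yp hh' E1' E2'.
lia.
Qed.

(** * Counting the forms in terms of their small roots *)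

Lemma bqf_coord_norm (R : realType) (N : 'rV[R]_3 -> R) (c : R) (q : bqf int) : 0 < c ->
  (forall v, c * `|v| <= N v) ->
  [/\ (absz (bqf_a q))%:R <= bqf_norm N q / c, (absz (bqf_b q))%:R <= bqf_norm N q / c
    & (absz (bqf_c q))%:R <= bqf_norm N q / c].
Proof.
move=> c0 cN; have h (i : 'I_3) : (absz (q 0 i))%:R <= bqf_norm N q / c.
  rewrite ler_pdivlMr // mulrC; apply: le_trans (cN _); rewrite ler_pM2l //.
  have := row_coord_le_norm (map_mx intr q : 'rV[R]_3) i; rewrite mxE -intr_norm.
  by rewrite -abszE.
by split; exact: h.
Qed.

Lemma bqf_norm_opp (R : realType) (N : 'rV[R]_3 -> R) (hN : is_norm N) (q : bqf int) :
  bqf_norm N (- q) = bqf_norm N q.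
Proof. by rewrite /bqf_norm map_mxN is_norm_opp. Qed.

Definition root_forms (k n : nat) w (ts : root_index -> seq int) : seq (bqf int) :=
  [seq root_form k w i t | i <- roots_upto n, t <- ts i].

Lemma size_root_forms k n w ts :
  size (root_forms k n w ts) = (\sum_(i <- roots_upto n) size (ts i))%N.
Proof. by rewrite size_allpairs_dep sumnE big_map. Qed.

(** By [small_root_exists] each form counted, or its opposite, occurs in the
    progression of some [i] of the box, with [|t| <= T / N(v^2) + M]. *)
Lemma bqf_count_upper (R : realType) (N : 'rV[R]_3 -> R) (k : nat) (w : root_index -> int * int)
    (c M T : R) (n : nat) :
  is_norm N -> (0 < k)%N -> is_complement w ->
  0 < c -> (forall v, c * `|v| <= N v) -> 0 <= M -> 0 <= T ->
  norm_progression N k w M ->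
  T / c + k%:R < n.+1%:R ^+ 2 ->
  finite_set [set q | int_bqf (k%:Z ^+ 2) q /\ bqf_norm N q < T] /\
  (bqf_count N (k%:Z ^+ 2) T)%:R <=
    2 * \sum_(i <- roots_upto n) (2 * (T / N (root_sqr R i) + M) + 1).
Proof.
move=> hN k0 hw c0 cN M0 T0 FB Tn.
pose S i := Num.truncn (T / N (root_sqr R i) + M).
pose L := root_forms k n w (fun i => near_ints (S i)).
have inL q : int_bqf (k%:Z ^+ 2) q /\ bqf_norm N q < T -> q \in L ++ map -%R L.
  move=> [dq qT]; have [qa qb qc] := bqf_coord_norm q c0 cN.
  have lt_n (z : int) : (absz z)%:R <= bqf_norm N q / c -> (absz z + k < n.+1 ^ 2)%N.
    move=> zq; rewrite -(ltr_nat R) natrD natrX; apply: le_lt_trans Tn.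
    by rewrite lerD2r; apply: le_trans zq _; rewrite ler_pM2r ?invr_gt0 // ltW.
  have [[[b p] j] hi [t tE]] := small_root_exists hw k0 dq (lt_n _ qa) (lt_n _ qb) (lt_n _ qc).
  have := hi; rewrite mem_roots_upto => /and3P[_ hj cpj].
  have [F0 /(_ t)] := FB b p j hj cpj; set F := N _ in F0 * => Ft.
  have Nt : bqf_norm N (root_form k w (b, p, j) t) < T.
    by case: tE => <-; rewrite ?bqf_norm_opp.
  have rL : root_form k w (b, p, j) t \in L.
    apply/allpairsPdep; exists (b, p, j), t; split=> //; apply: mem_near_ints.
    rewrite /S truncn_ge_nat -/F; last by rewrite addr_ge0 // divr_ge0 // ltW.
    rewrite -(ler_pM2r F0) mulrDl divfK ?gt_eqF //.
    by move: Ft; rewrite ler_norml; lra.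
  rewrite mem_cat; case: tE => [->|qE]; first by rewrite rL.
  by apply/orP; right; apply/mapP; exists (root_form k w (b, p, j) t); rewrite // -qE opprK.
have [fQ szQ] := card_fset_set_le inL; split=> //.
apply: (@le_trans _ _ (size (L ++ map -%R L))%:R); first by rewrite ler_nat.
rewrite size_cat size_map addnn -mul2n natrM ler_pM2l //.
rewrite size_root_forms natr_sum !big_seq ler_sum // => -[[b p] j].
rewrite mem_roots_upto => /and3P[_ hj cpj]; have [F0 _] := FB b p j hj cpj.
rewrite size_map size_iota -natr1 natrM lerD2r ler_pM2l // truncn_le.
by rewrite addr_ge0 // divr_ge0 // ltW.
Qed.

(** The forms with [2 k < |t| < T / N(v^2) - M] and their opposites are counted,
    and are pairwise distinct. *)
Lemma bqf_count_lower (R : realType) (N : 'rV[R]_3 -> R) (k : nat) (w : root_index -> int * int)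
    (M T : R) (n : nat) :
  is_norm N -> (0 < k)%N -> is_complement w ->
  norm_progression N k w M ->
  finite_set [set q | int_bqf (k%:Z ^+ 2) q /\ bqf_norm N q < T] ->
  2 * \sum_(i <- roots_upto n) (2 * (T / N (root_sqr R i) - M) - (4 * k)%:R - 4) <=
  (bqf_count N (k%:Z ^+ 2) T)%:R.
Proof.
move=> hN k0 hw FB fQ.
(* The final [- 1] makes the inequality [|t| < T / N(v^2) - M] strict for
   [|t| <= 2 k + S i]; a negative bound is truncated to an empty window. *)
pose S i := Num.truncn (T / N (root_sqr R i) - M - (2 * k)%:R - 1).
pose L := root_forms k n w (fun i => far_ints (2 * k) (S i)).
have LP q : q \in L -> exists b p j t, [/\ (0 < j <= 2 * p)%N, coprime p j,
     (2 * k < absz t <= 2 * k + S (b, p, j))%N & q = root_form k w (b, p, j) t].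
  move=> /allpairsPdep[[[b p] j] [t [+ /mem_far_ints ht ->]]].
  by rewrite mem_roots_upto => /and3P[_ hj cpj]; exists b, p, j, t.
have LQ q : q \in L -> int_bqf (k%:Z ^+ 2) q /\ bqf_norm N q < T.
  move=> /LP[b [p [j [t [hj cpj /andP[tk tS] ->]]]]].
  split; first exact: disc_root_form.
  have [F0 /(_ t)] := FB b p j hj cpj; set F := N _ in F0 *.
  have S0 : (0 < S (b, p, j))%N by lia.
  have x1 : 1 <= T / F - M - (2 * k)%:R - 1 by rewrite -truncn_gt0.
  have : (S (b, p, j))%:R <= T / F - M - (2 * k)%:R - 1 by rewrite truncn_le; lra.
  have : (absz t)%:R <= (2 * k)%:R + (S (b, p, j))%:R :> R.
    by rewrite -natrD ler_nat.
  move=> h1 h2; have : (absz t)%:R < T / F - M by lra.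
  rewrite -(ltr_pM2r F0) mulrBl divfK ?gt_eqF // ler_norml; lra.
have uL : uniq (L ++ map -%R L).
  rewrite cat_uniq map_inj_uniq ?andbT; last exact: oppr_inj.
  have -> : uniq L.
    apply: allpairs_uniq_dep; first exact: uniq_roots_upto.
      by move=> i _; exact: uniq_far_ints.
    move=> ? ? /allpairsPdep[[[b p] j] [t [+ _ ->]]].
    rewrite mem_roots_upto => /and3P[_ hj cpj].
    move=> /allpairsPdep[[[b' p'] j'] [t' [+ _ ->]]] /=.
    rewrite mem_roots_upto => /and3P[_ hj' cpj'].
    by case/(root_form_inj hw k0 hj cpj hj' cpj') => -> ->.
  rewrite andbT /=; apply/hasPn => q /mapP[q' /LP[b [p [j [t [hj cpj /andP[tk _] ->]]]]] ->].
  apply/negP => /LP[b' [p' [j' [t' [hj' cpj' /andP[tk' _] E]]]]].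
  by apply: (root_form_far_opp hw k0 hj' cpj' hj cpj tk' tk (esym E)).
have LLQ q : q \in L ++ map -%R L -> int_bqf (k%:Z ^+ 2) q /\ bqf_norm N q < T.
  rewrite mem_cat => /orP[/LQ //|/mapP[q' /LQ[dq' q'T] ->]].
  rewrite bqf_norm_opp //; split=> //; rewrite /int_bqf /= -dq'.
  by rewrite [q']bqf_mkE bqf_mkN !disc_bqf_mk; ring.
apply: (@le_trans _ _ (size (L ++ map -%R L))%:R); last first.
  by rewrite ler_nat; exact: card_fset_set_ge.
rewrite size_cat size_map addnn -mul2n [leRHS]natrM ler_pM2l //.
rewrite size_root_forms natr_sum ler_sum // => i _.
rewrite size_cat !size_map size_iota natrD natrM.
have := truncnS_gt (T / N (root_sqr R i) - M - (2 * k)%:R - 1).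
rewrite -/(S i) -natr1 natrM; lra.
Qed.

(** * The sum over the box and the asymptotic count *)

Lemma is_norm_inv_bounds (R : realType) n (N : 'rV[R]_n -> R) (hN : is_norm N) :
  exists2 L, 0 <= L & exists2 m, 0 < m &
    (forall u v, 1 <= `|u| -> 1 <= `|v| -> `|(N u)^-1 - (N v)^-1| <= L * `|u - v|) /\
    (forall u, 1 <= `|u| <= 2 -> m <= (N u)^-1).
Proof.
have [c c0 cN] := is_norm_ge_sup hN; have [C C0 NC] := is_norm_le_sup hN.
have Nc u : 1 <= `|u| -> c <= N u.
  by move=> u1; apply: le_trans (cN u); rewrite -[leLHS]mulr1 ler_pM2l.
have N0 u : 1 <= `|u| -> 0 < N u by move=> /Nc; exact: lt_le_trans.
exists (C / (c * c)); first by rewrite divr_ge0 ?mulr_ge0 // ltW.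
exists (C * 2)^-1; first by rewrite invr_gt0 mulr_gt0.
split=> [u v u1 v1|u /andP[u1 u2]]; last first.
  rewrite lef_pV2 ?posrE ?mulr_gt0 ?N0 //; apply: le_trans (NC u) _.
  by rewrite ler_pM2l.
have -> : (N u)^-1 - (N v)^-1 = (N v - N u) / (N u * N v).
  by have := N0 u u1; have := N0 v v1 => ? ?; field; rewrite !gt_eqF.
rewrite normrM distrC [leRHS]mulrAC.
apply: ler_pM => //; first by apply: le_trans (is_norm_dist hN _ _) (NC _).
rewrite ger0_norm; last by rewrite invr_ge0 mulr_ge0 ?ltW ?N0.
by rewrite lef_pV2 ?posrE ?mulr_gt0 ?N0 // ler_pM ?Nc // ltW.
Qed.

(** The values of [1 / N(v^2)] at the vectors [v = (1, x - 1)] and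
    [v = (1 - x, 1)], which for [0 < x <= 2] run through half of the boundary of
    the unit square of the sup norm. *)
Definition edge_density (R : realType) (N : 'rV[R]_3 -> R) (x : R) : R :=
  (N (lin_mul 1 (x - 1) 1 (x - 1)))^-1 + (N (lin_mul (1 - x) 1 (1 - x) 1))^-1.

Lemma edge_density_regular (R : realType) (N : 'rV[R]_3 -> R) (hN : is_norm N) :
  exists L, exists2 m, 0 < m &
    (forall x, 0 <= x <= 2 -> m <= edge_density N x) /\
    (forall x y, 0 <= x <= 2 -> 0 <= y <= 2 ->
      `|edge_density N x - edge_density N y| <= L * `|x - y|).
Proof.
have [L L0 [m m0 [NL Nm]]] := is_norm_inv_bounds hN.
have sup_mk (a b c M : R) : `|a| <= M -> `|b| <= M -> `|c| <= M -> `|bqf_mk a b c| <= M.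
  move=> aM bM cM; apply: row_norm_le; first exact: le_trans aM.
  by move=> -[[|[|[|//]]] ?]; rewrite mxE.
have mk_sup (a b c M : R) : M <= `|a| \/ M <= `|c| -> M <= `|bqf_mk a b c|.
  have [Ea _ Ec] := bqf_mkK a b c.
  by case=> h; apply: le_trans h _; [rewrite -[in leLHS]Ea | rewrite -[in leLHS]Ec];
    exact: row_coord_le_norm.
have one1 (y : R) : 1 <= `|lin_mul 1 y 1 y|.
  by apply: mk_sup; left; rewrite mulr1 normr1.
have two1 (y : R) : 1 <= `|lin_mul y 1 y 1|.
  by apply: mk_sup; right; rewrite mulr1 normr1.
have one2 (y : R) : `|y| <= 1 -> `|lin_mul 1 y 1 y| <= 2.
  by rewrite ler_norml => y1; apply: sup_mk; rewrite ler_norml; nra.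
have two2 (y : R) : `|y| <= 1 -> `|lin_mul y 1 y 1| <= 2.
  by rewrite ler_norml => y1; apply: sup_mk; rewrite ler_norml; nra.
have sqr_lip (y z : R) : `|y| <= 1 -> `|z| <= 1 -> `|y * y - z * z| <= 2 * `|y - z|.
  move=> y1 z1; rewrite (_ : y * y - z * z = (y + z) * (y - z)); last by ring.
  by rewrite normrM ler_wpM2r // (le_trans (ler_normD _ _)) //; lra.
have dbl (y z : R) : `|1 * y + y * 1 - (1 * z + z * 1)| <= 2 * `|y - z|.
  rewrite (_ : _ - _ = 2 * (y - z)); last by ring.
  by rewrite normrM ger0_norm.
have one_lip (y z : R) : `|y| <= 1 -> `|z| <= 1 ->
    `|lin_mul 1 y 1 y - lin_mul 1 z 1 z| <= 2 * `|y - z|.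
  move=> y1 z1; rewrite /lin_mul bqf_mkN bqf_mkD; apply: sup_mk => //.
  - by rewrite subrr normr0 mulr_ge0.
  - exact: sqr_lip.
have two_lip (y z : R) : `|y| <= 1 -> `|z| <= 1 ->
    `|lin_mul y 1 y 1 - lin_mul z 1 z 1| <= 2 * `|y - z|.
  move=> y1 z1; rewrite /lin_mul bqf_mkN bqf_mkD; apply: sup_mk.
  - exact: sqr_lip.
  - by have := dbl y z; rewrite !mul1r !mulr1.
  - by rewrite subrr normr0 mulr_ge0.
have cent (x : R) : 0 <= x <= 2 -> `|x - 1| <= 1 /\ `|1 - x| <= 1.
  by move=> hx; rewrite !ler_norml; lra.
exists (L * 2 + L * 2), m => //; split=> [x /cent[x1 x1']|x y /cent[x1 x1'] /cent[y1 y1']].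
  have h1 : m <= (N (lin_mul 1 (x - 1) 1 (x - 1)))^-1 by rewrite Nm // one1 one2.
  have h2 : m <= (N (lin_mul (1 - x) 1 (1 - x) 1))^-1 by rewrite Nm // two1 two2.
  rewrite /edge_density; apply: le_trans h1 _; rewrite lerDl; apply: le_trans h2; exact: ltW.
rewrite /edge_density opprD addrACA; apply: le_trans (ler_normD _ _) _.
rewrite mulrDl -!mulrA; apply: lerD.
  apply: le_trans (NL _ _ (one1 _) (one1 _)) _; rewrite ler_wpM2l //.
  apply: le_trans (one_lip _ _ x1 y1) _.
  by rewrite (_ : x - 1 - (y - 1) = x - y) //; ring.
apply: le_trans (NL _ _ (two1 _) (two1 _)) _; rewrite ler_wpM2l //.
apply: le_trans (two_lip _ _ x1' y1') _.
by rewrite distrC (_ : 1 - y - (1 - x) = x - y) //; ring.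
Qed.

Lemma sum_inv_root_sqr (R : realType) (N : 'rV[R]_3 -> R) (hN : is_norm N) n :
  \sum_(i <- roots_upto n) (N (root_sqr R i))^-1 = farey_sum (edge_density N) n.
Proof.
rewrite sum_roots_upto /farey_sum; apply: eq_big_nat => p /andP[p0 _].
rewrite /coprime_sum mulr_sumr; apply: eq_bigr => j _.
have P0 : p%:R != 0 :> R by rewrite pnatr_eq0 -lt0n.
have scale (x y : R) (v : 'rV[R]_3) : v = p%:R ^+ 2 *: lin_mul x y x y ->
    (N v)^-1 = p%:R ^- 2 * (N (lin_mul x y x y))^-1.
  by move=> ->; rewrite (is_norm_homogeneous hN) ger0_norm ?exprn_ge0 // invfM.
rewrite /edge_density mulrDr; congr (_ + _); apply: scale;
  rewrite /root_sqr /lin_mul map_bqf_mk bqf_mkZ /root_vec /=;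
  congr bqf_mk; rewrite !(rmorphB, rmorphM, rmorphD) /= -!pmulrn; (field; by rewrite ?P0).
Qed.

(** Each of the at most [4 n^2] vectors of the box contributes [4 T / N(v^2)], up
    to a bounded error: two windows of [2 T / N(v^2)] integers [t], for [q] and
    for [- q]. *)
Lemma bqf_count_sandwich (R : realType) (N : 'rV[R]_3 -> R) (hN : is_norm N) (k : nat) :
  (0 < k)%N -> exists2 c, 0 < c & exists2 K, 0 <= K & forall (T : R) n, 0 <= T ->
    T / c + k%:R < n.+1%:R ^+ 2 ->
    `|(bqf_count N (k%:Z ^+ 2) T)%:R - 4 * T * farey_sum (edge_density N) n|
      <= K * n%:R ^+ 2.
Proof.
move=> k0; have [w hw] := complement_exists; have [c c0 cN] := is_norm_ge_sup hN.
have [M M0 FB] := norm_progression_exists hN k hw.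
exists c => //; exists (4 * (4 * M + 8 * k%:R + 8)).
  by rewrite mulr_ge0 // !addr_ge0 // mulr_ge0.
move=> T n T0 Tn; have [fQ ub] := @bqf_count_upper R N k w c M T n hN k0 hw c0 cN M0 T0 FB Tn.
have lb := @bqf_count_lower R N k w M T n hN k0 hw FB fQ.
have ub' : \sum_(i <- roots_upto n) (2 * (T / N (root_sqr R i) + M) + 1) =
    2 * T * farey_sum (edge_density N) n + (2 * M + 1) * (size (roots_upto n))%:R.
  rewrite -sum_inv_root_sqr // mulr_sumr -sum1_size natr_sum mulr_sumr -big_split /=.
  by apply: eq_bigr => i _; ring.
have lb' : \sum_(i <- roots_upto n) (2 * (T / N (root_sqr R i) - M) - (4 * k)%:R - 4) =
    2 * T * farey_sum (edge_density N) n
    - (2 * M + 4 * k%:R + 4) * (size (roots_upto n))%:R.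
  rewrite -sum_inv_root_sqr // mulr_sumr -sum1_size natr_sum mulr_sumr -sumrB /=.
  by apply: eq_bigr => i _; rewrite natrM; ring.
rewrite ub' in ub; rewrite lb' in lb.
have : (size (roots_upto n))%:R <= 4 * n%:R ^+ 2 :> R.
  by rewrite -natrX -natrM ler_nat size_roots_upto.
move: ub lb {ub' lb'}; set s := (size _)%:R; set G := farey_sum _ _ => ub lb sn.
have s0 : 0 <= s by rewrite /s.
rewrite ler_distl; have : 0 <= k%:R :> R by [].
move: (k%:R : R) lb => kr lb kr0; nra.
Qed.

Lemma bqf_count_asymptotic (R : realType) (N : 'rV[R]_3 -> R) (hN : is_norm N) (k : nat) :
  (0 < k)%N -> exists2 c0, 0 < c0 & exists K, forall T : R, 1 <= T ->
    `|(bqf_count N (k%:Z ^+ 2) T)%:R - c0 * (T * ln T)| <= K * T.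
Proof.
move=> k0; have [c c0 [K K0 HK]] := bqf_count_sandwich hN k0.
have [L [m m0 [gm gL]]] := edge_density_regular hN.
have [cf cf0 [Kf HKf]] := farey_sum_asymptotic m0 gm gL.
exists (2 * cf); first by rewrite mulr_gt0.
pose A : R := c^-1 + k%:R.
have A0 : 0 < A by rewrite ltr_pwDr ?ltr0n // invr_ge0 ltW.
pose K2 : R := `|ln A| + `|ln c| + ln 2.
exists (K * A + 4 * Kf + 4 * cf * K2) => T T1.
have T0 : 0 < T by exact: lt_le_trans T1.
have kR : 1 <= k%:R :> R by rewrite ler1n.
pose X : R := T / c + k%:R.
have X1 : 1 <= X by rewrite /X ler_wpDl // divr_ge0 // ltW.
have XA : X <= A * T by rewrite /X /A mulrDl [c^-1 * T]mulrC lerD2l ler_peMr.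
(* As [n + 1] exceeds the square root of [X], the box of size [n] contains the
   first root of each form counted or of its opposite. *)
pose n := Num.truncn (Num.sqrt X).
have n1 : (0 < n)%N.
  by rewrite truncn_gt0 -[leLHS]sqrtr1 ler_sqrt //; apply: le_trans X1.
have X0 : 0 <= X by exact: le_trans X1.
have nX : n%:R ^+ 2 <= X.
  by rewrite -[leRHS]sqr_sqrtr // ler_pXn2r ?nnegrE ?sqrtr_ge0 // truncn_le sqrtr_ge0.
have Xn : X < n.+1%:R ^+ 2.
  by rewrite -[ltLHS]sqr_sqrtr // ltr_pXn2r ?nnegrE ?sqrtr_ge0 // truncnS_gt.
have N0 : 0 < n%:R :> R by rewrite ltr0n.
have lnn : `|ln n%:R - ln T / 2| <= K2.
  have u1 : 2 * ln (n%:R : R) <= ln A + ln T.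
    rewrite -lnM ?posrE // mulr_natl -lnXn // ler_ln ?posrE ?exprn_gt0 ?mulr_gt0 //.
    exact: le_trans nX XA.
  have u2 : ln T - ln c <= 2 * ln (n.+1%:R : R).
    rewrite -ln_div ?posrE // mulr_natl -lnXn // ler_ln ?posrE ?exprn_gt0 ?divr_gt0 //.
    by apply: le_trans (ltW Xn); rewrite /X lerDl.
  have u3 : ln (n.+1%:R : R) <= ln 2 + ln n%:R.
    rewrite -lnM ?posrE // ler_ln ?posrE ?mulr_gt0 // -natrM ler_nat.
    by rewrite mul2n -addnn -addn1 leq_add2l.
  have u4 : 0 <= ln (2 : R) by rewrite ln_ge0 // ler1n.
  have := ler_norm (ln A); have := ler_norm (ln c).
  have := normr_ge0 (ln A); have := normr_ge0 (ln c).
  rewrite /K2 ler_norml; move: (`|ln A|) (`|ln c|) => nA nc; lra.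
have H1 := HK T n (ltW T0) Xn; have H2 := HKf n n1.
(* The factor [2 cf] is [4 cf] times the [1/2] of [ln n = (ln T) / 2 + O(1)]. *)
have -> : (bqf_count N (k%:Z ^+ 2) T)%:R - 2 * cf * (T * ln T) =
   ((bqf_count N (k%:Z ^+ 2) T)%:R - 4 * T * farey_sum (edge_density N) n)
   + 4 * T * (farey_sum (edge_density N) n - cf * ln n%:R)
   + 4 * T * cf * (ln n%:R - ln T / 2) by field.
apply: le_trans (ler_normD _ _) _; rewrite [leRHS]mulrDl; apply: lerD.
  apply: le_trans (ler_normD _ _) _; rewrite [leRHS]mulrDl; apply: lerD.
    by apply: le_trans H1 _; rewrite -mulrA ler_wpM2l // (le_trans nX).
  rewrite normrM ger0_norm ?mulr_ge0 ?(ltW T0) //.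
  by rewrite [leRHS]mulrAC ler_pM2l // mulr_gt0.
rewrite normrM ger0_norm ?mulr_ge0 ?(ltW T0) ?(ltW cf0) //.
rewrite (_ : 4 * cf * K2 * T = 4 * T * cf * K2); last by ring.
by rewrite ler_pM2l // !mulr_gt0.
Qed.

Theorem theorem1p5 (R : realType) (N : 'rV[R]_3 -> R) (hN : is_norm N)
    (d : int) (hd0 : d != 0) (hdsq : exists k : int, d = k ^+ 2) :
  exists2 c0 : R, 0 < c0 &
    (fun T : R => (bqf_count N d T)%:R : R^o) ~_(+oo_R) (fun T : R => c0 * (T * ln T)).
Proof.
case: hdsq => k dE; pose l := absz k.
have l0 : (0 < l)%N by rewrite absz_gt0; apply: contraNneq hd0 => k0; rewrite dE k0 expr0n.
have dl : d = l%:Z ^+ 2 by rewrite dE abszE real_normK // num_real.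
have [c0 c00 [K HK]] := bqf_count_asymptotic hN l0.
exists c0 => //; apply/eqaddoP => e /= e0; near=> T.
have T1 : 1 <= T by near: T; exact: nbhs_pinfty_ge.
have lnT : K / (e * c0) <= ln T.
  have : expR (K / (e * c0)) <= T by near: T; exact: nbhs_pinfty_ge.
  by move=> h; rewrite -ler_expR lnK // posrE (lt_le_trans _ T1).
rewrite dl; apply: le_trans (HK T T1) _.
have T0 : 0 < T by exact: lt_le_trans T1.
rewrite !normrM (gtr0_norm c00) (gtr0_norm T0) (ger0_norm (ln_ge0 T1)).
rewrite (_ : e * _ = ln T * (e * c0) * T); last by ring.
by rewrite ler_pM2r // -ler_pdivrMr // mulr_gt0.
Unshelve. all: by end_near.
Qed.
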